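(* Let $\mathbb K\in\{\mathbb R,\mathbb C\}$ and let $x_0$ be any linear coordinate on $\mathfrak{gl}(3,\mathbb K)^*=\mathfrak{sl}(3,\mathbb K)^*\oplus\mathbb K^*\cong\mathfrak{sl}(3,\mathbb K)\oplus\mathbb K=\mathfrak{gl}(3,\mathbb K)$ proportional (with nonzero factor) to the function $\mathrm{Trace}(\cdot)$. For $b=(b_0,\dots,b_9)\in\mathbb K^{10}$ let $X_b=b_0X_0+\cdots+b_9X_9$ be the quadratic vector field and $Q_b\in U$ the quadratic polynomial on $\mathfrak{sl}(3,\mathbb K)^*$ described in the context, so that $[[X_b,P],[X_b,P]]=2P(Q_b)\wedge P$; treat them as objects on $\mathfrak{gl}(3,\mathbb K)^*$ independent of $x_0$. Put $$\widetilde X_b=X_b+Q_b\frac{\partial}{\partial x_0}-x_0E .$$ Then $$\pi_2(b):=[\widetilde X_b,\pi_1]=[X_b,\pi_1]-\pi_1(Q_b)\wedge\frac{\partial}{\partial x_0}+x_0\pi_1$$ is a centrally linearizable quadratic Poisson bivector on $\mathfrak{gl}(3,\mathbb K)^*$, where $\pi_1$ is the Lie–Poisson bivector of $\mathfrak{gl}(3,\mathbb K)^*$.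
   Context: $[\cdot,\cdot]$ is the Schouten bracket, normalized by $[X,f]=Xf$, $[X,Y]$ the Lie bracket for vector fields, $[R,Q]=-(-1)^{(r-1)(q-1)}[Q,R]$, $[R,Q\wedge S]=[R,Q]\wedge S+(-1)^{(r-1)q}Q\wedge[R,S]$ for $R,Q$ of degrees $r,q$. For a bivector $\eta$ and a function $f$, $\eta(f):=[\eta,f]$ (contraction of $\eta$ with $df$ over the second index, so $\eta(f)g=\{g,f\}_\eta$). $\eta$ is Poisson if $[\eta,\eta]=0$. With $\mathfrak s=\mathfrak{sl}(3,\mathbb K)$ and $\mathfrak g=\mathfrak s\oplus\mathbb K=\mathfrak{gl}(3,\mathbb K)$, a quadratic (homogeneous quadratic coefficients) Poisson bivector $\pi_2$ on $\mathfrak g^*=\mathfrak s^*\oplus\mathbb K^*$ ($\mathbb K^*$ the dual line of the centre) is centrally linearizable if there is $a\in\mathbb K^*\subset\mathfrak g^*$, $a\ne0$, with $\pi_2(a)=0$ and $[T_a,\pi_2]=\pi_1$, where $T_a$ is the constant vector field with value $a$. Objects on $\mathfrak s^*$ are treated as objects on $\mathfrak g^*$ independent of $x_0$ and without $\partial/\partial x_0$ component; $E$ is the Euler vector field of $\mathfrak s^*$ treated this way. $P$ is the Lie–Poisson bivector on $\mathfrak{sl}(3,\mathbb K)^*$. Coordinates on $\mathfrak{sl}(3,\mathbb K)^*$: $x_{ij}$ ($i\ne j$), $y_{13}=x_{11}-x_{33}$, $y_{23}=x_{22}-x_{33}$, the linear functions given by the matrices $E_{ij}$, $E_{11}-E_{33}$,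 $E_{22}-E_{33}$; the bracket of $P$ is $\{x_{ij},x_{kl}\}=\delta_{jk}x_{il}-\delta_{il}x_{kj}$. $\mathfrak{sl}(3,\mathbb K)$ acts on multivector fields and functions on $\mathfrak{sl}(3,\mathbb K)^*$ by Lie derivatives along $P(x)$, $x\in\mathfrak{sl}(3,\mathbb K)$. $W^*$ is the 10-dimensional irreducible submodule (isomorphic to $S^3(V^* )$, $V$ the natural representation) of the space of quadratic vector fields generated by the zero weight vector $$\begin{aligned}X_0={}&((4y_{13}-2y_{23})x_{12}-6x_{13}x_{32})\tfrac{\partial}{\partial x_{12}}+((-4y_{13}+2y_{23})x_{13}+6x_{12}x_{23})\tfrac{\partial}{\partial x_{13}}\\&+((2y_{13}-4y_{23})x_{21}+6x_{23}x_{31})\tfrac{\partial}{\partial x_{21}}+((-2y_{13}+4y_{23})x_{23}-6x_{13}x_{21})\tfrac{\partial}{\partial x_{23}}\\&+((-2y_{13}-2y_{23})x_{31}-6x_{32}x_{21})\tfrac{\partial}{\partial x_{31}}+((2y_{13}+2y_{23})x_{32}+6x_{12}x_{31})\tfrac{\partial}{\partial x_{32}}\\&+(-2y_{13}^2-4y_{13}y_{23}+4y_{23}^2)\tfrac{\partial}{\partial y_{13}}+(-4y_{13}^2+4y_{13}y_{23}+2y_{23}^2)\tfrac{\partial}{\partial y_{23}}.\end{aligned}$$ All weight spaces of $W^*$ are one-dimensional, and they are generated by $X_0$ and, up to nonzero constant factors, $X_1=-[P(x_{12}),X_0]$, $X_2=-[P(x_{13}),X_0]$, $X_3=-[P(x_{21}),X_0]$,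 $X_4=-[P(x_{23}),X_0]$, $X_5=-[P(x_{31}),X_0]$, $X_6=-[P(x_{32}),X_0]$, $X_7=-[P(x_{12}),X_6]$, $X_8=-[P(x_{13}),X_4]$, $X_9=-[P(x_{31}),X_3]$. $U$ is the 27-dimensional irreducible submodule (highest weight $2\omega_1+2\omega_2$) of the space of homogeneous quadratic polynomials on $\mathfrak{sl}(3,\mathbb K)^*$, i.e. the submodule generated by $x_{13}^2$. For each $b$, $Q_b\in U$ denotes a quadratic polynomial with $[[X_b,P],[X_b,P]]=2P(Q_b)\wedge P$ (such a polynomial exists for every $b\in\mathbb K^{10}$). *)

(* Defs.v *)
From HB Require Import structures.
From mathcomp Require Import all_boot all_order all_algebra.
From mathcomp Require Import mpoly complex reals.

Set Implicit Arguments.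
Unset Strict Implicit.
Unset Printing Implicit Defensive.

Import GRing.Theory.

Local Open Scope ring_scope.

Inductive real_or_complex := RealScalars | ComplexScalars.

Definition scalars (R : realType) (s : real_or_complex) : fieldType :=
  match s with
  | RealScalars => (R : fieldType)
  | ComplexScalars => (R[i] : fieldType)
  end.

(* Polynomial multivector fields on K^n, of mixed degree: the value of R at
   I = {i_1 < ... < i_r} is the coefficient of d_{i_1} /\ ... /\ d_{i_r}. *)
Notation mvfield K n := {ffun {set 'I_n} -> {mpoly K[n]}}.

Section Multivectors.
Variables (K : fieldType) (n : nat).
Implicit Types (R Q : mvfield K n) (f : {mpoly K[n]}) (i : 'I_n).

Definition mvfun f : mvfield K n := [ffun I => if I == set0 then f else 0].

Definition partial i : mvfield K n := [ffun I => (I == [set i])%:R].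

(* d_A /\ d_B = (-1) ^+ inversions A B *: d_{A u B} for disjoint A and B *)
Definition inversions (A B : {set 'I_n}) : nat :=
  #|[set p : 'I_n * 'I_n | [&& p.1 \in A, p.2 \in B & (p.2 < p.1)%N]]|.

Definition wedge R Q : mvfield K n :=
  [ffun I : {set 'I_n} => \sum_(A : {set 'I_n} | A \subset I)
     (-1) ^+ inversions A (I :\: A) * (R A * Q (I :\: A))].

Definition mvderiv i R : mvfield K n := [ffun I => (R I)^`M(i)].

(* Left and right derivatives with respect to the odd variable d_i: they
   remove the factor d_i after moving it to the front, respectively to the
   back. *)
Definition lodd i R : mvfield K n :=
  [ffun I : {set 'I_n} => if i \in I then 0 else
     (-1) ^+ #|[set a in I | (a < i)%N]| * R (i |: I)].

Definition rodd i R : mvfield K n :=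
  [ffun I : {set 'I_n} => if i \in I then 0 else
     (-1) ^+ #|[set a in I | (i < a)%N]| * R (i |: I)].

(* Schouten bracket, normalized by [X, f] = X f, [X, Y] = Lie bracket,
   [R, Q] = - (-1)^((r-1)(q-1)) [Q, R] and
   [R, Q /\ S] = [R, Q] /\ S + (-1)^((r-1)q) Q /\ [R, S],
   which in terms of odd variables is the formula below. *)
Definition schouten R Q : mvfield K n :=
  \sum_(i < n) (wedge (rodd i R) (mvderiv i Q) - wedge (mvderiv i R) (lodd i Q)).

Definition is_bivector R : Prop :=
  forall I : {set 'I_n}, R I != 0 -> #|I| = 2%N.

Definition is_quadratic R : Prop := forall I : {set 'I_n}, R I \is 2.-homog.

Definition is_poisson R : Prop := schouten R R = 0.

Definition const_field (a : 'rV[K]_n) : mvfield K n :=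
  \sum_(i < n) a 0 i *: partial i.

Definition vanishes_at R (a : 'rV[K]_n) : Prop :=
  forall I : {set 'I_n}, (R I).@[fun i => a 0 i] = 0.

Definition euler : mvfield K n := \sum_(i < n) wedge (mvfun 'X_i) (partial i).

Definition vector_field (p : seq {mpoly K[n]}) : mvfield K n :=
  \sum_(i < n) wedge (mvfun p`_i) (partial i).

(* The Lie-Poisson bivector of a Lie algebra of 3 x 3 matrices with basis
   e_0, ..., e_(n-1); lin sends a matrix of the Lie algebra to the
   corresponding linear function on the dual, 'X_i being that of e_i. *)
Definition lie_poisson (e : seq 'M[K]_3) (lin : 'M[K]_3 -> {mpoly K[n]}) :
    mvfield K n :=
  \sum_(i < n) \sum_(j < n | (i < j)%N)
     wedge (mvfun (lin (e`_i *m e`_j - e`_j *m e`_i)))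
           (wedge (partial i) (partial j)).

End Multivectors.

Section SL3.
Variable K : fieldType.

(* Matrix units and matrix entries with indices 1, 2, 3. *)
Definition Emx (i j : nat) : 'M[K]_3 := delta_mx (inord i.-1) (inord j.-1).
Definition entry (M : 'M[K]_3) (i j : nat) : K := M (inord i.-1) (inord j.-1).

(* The coordinates on sl(3)^* given by this basis are, in this order,
   x12, x13, x21, x23, x31, x32, y13, y23. *)
Definition sl3_basis : seq 'M[K]_3 :=
  [:: Emx 1 2; Emx 1 3; Emx 2 1; Emx 2 3; Emx 3 1; Emx 3 2;
      Emx 1 1 - Emx 3 3; Emx 2 2 - Emx 3 3].

(* Coordinates in sl3_basis of a traceless matrix M: its diagonal part is
   M11 (E11 - E33) + M22 (E22 - E33). *)
Definition sl3_coord (M : 'M[K]_3) : seq K :=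
  [:: entry M 1 2; entry M 1 3; entry M 2 1; entry M 2 3; entry M 3 1;
      entry M 3 2; entry M 1 1; entry M 2 2].

Definition sl3_lin (M : 'M[K]_3) : {mpoly K[8]} :=
  \sum_(k < 8) (sl3_coord M)`_k *: 'X_k.

Definition P : mvfield K 8 := lie_poisson sl3_basis sl3_lin.

Definition x (i j : nat) : {mpoly K[8]} := sl3_lin (Emx i j).
Definition y13 : {mpoly K[8]} := sl3_lin (Emx 1 1 - Emx 3 3).
Definition y23 : {mpoly K[8]} := sl3_lin (Emx 2 2 - Emx 3 3).

Definition Pham (f : {mpoly K[8]}) : mvfield K 8 := schouten P (mvfun f).

Definition X0 : mvfield K 8 := vector_field
  [:: (4 * y13 - 2 * y23) * x 1 2 - 6 * x 1 3 * x 3 2;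
      (- 4 * y13 + 2 * y23) * x 1 3 + 6 * x 1 2 * x 2 3;
      (2 * y13 - 4 * y23) * x 2 1 + 6 * x 2 3 * x 3 1;
      (- 2 * y13 + 4 * y23) * x 2 3 - 6 * x 1 3 * x 2 1;
      (- 2 * y13 - 2 * y23) * x 3 1 - 6 * x 3 2 * x 2 1;
      (2 * y13 + 2 * y23) * x 3 2 + 6 * x 1 2 * x 3 1;
      - 2 * y13 ^+ 2 - 4 * y13 * y23 + 4 * y23 ^+ 2;
      - 4 * y13 ^+ 2 + 4 * y13 * y23 + 2 * y23 ^+ 2].

Definition X1 := - schouten (Pham (x 1 2)) X0.
Definition X2 := - schouten (Pham (x 1 3)) X0.
Definition X3 := - schouten (Pham (x 2 1)) X0.
Definition X4 := - schouten (Pham (x 2 3)) X0.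
Definition X5 := - schouten (Pham (x 3 1)) X0.
Definition X6 := - schouten (Pham (x 3 2)) X0.
Definition X7 := - schouten (Pham (x 1 2)) X6.
Definition X8 := - schouten (Pham (x 1 3)) X4.
Definition X9 := - schouten (Pham (x 3 1)) X3.

Definition Xb (b : 'rV[K]_10) : mvfield K 8 :=
  \sum_(k < 10) b 0 k *: [:: X0; X1; X2; X3; X4; X5; X6; X7; X8; X9]`_k.

(* The sl(3)-submodule of polynomials generated by x13^2, where M in sl(3)
   acts by the Lie derivative along P(M). *)
Inductive in_U : {mpoly K[8]} -> Prop :=
| U_gen : in_U (x 1 3 ^+ 2)
| U_zero : in_U 0
| U_add f g : in_U f -> in_U g -> in_U (f + g)
| U_scale (a : K) f : in_U f -> in_U (a *: f)
| U_act (M : 'M[K]_3) f g : \tr M = 0 -> in_U f ->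
    mvfun g = schouten (Pham (sl3_lin M)) (mvfun f) -> in_U g.

End SL3.

Section GL3.
Variable K : fieldType.

(* Linear coordinates on gl(3)^* = sl(3)^* + K^*: 'X_ord0 is x_0 and
   'X_(lift ord0 k) is the k-th coordinate of sl(3)^*. *)
Definition x0 : {mpoly K[9]} := 'X_ord0.
Definition d0 : mvfield K 9 := partial K ord0.

Definition lift_poly (f : {mpoly K[8]}) : {mpoly K[9]} :=
  f \mPo [tuple 'X_(lift ord0 k) | k < 8].

Definition lift_field (R : mvfield K 8) : mvfield K 9 :=
  [ffun I : {set 'I_9} => if ord0 \in I then 0
     else lift_poly (R [set k | lift ord0 k \in I])].

Definition E : mvfield K 9 := lift_field (euler K 8).

(* A linear function on gl(3)^* is an element of gl(3): the functions
   proportional to Trace(.) under the identification gl(3)^* = gl(3) by the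
   trace form are the scalar matrices.  The coordinate x_0 = c Trace(.) is
   therefore the linear function given by c%:M (c != 0). *)
Definition gl3_basis (c : K) : seq 'M[K]_3 := c%:M :: sl3_basis K.

Definition gl3_lin (c : K) (M : 'M[K]_3) : {mpoly K[9]} :=
  (\tr M / (3 * c)) *: x0 + lift_poly (sl3_lin (M - (\tr M / 3)%:M)).

Definition pi1 (c : K) : mvfield K 9 := lie_poisson (gl3_basis c) (gl3_lin c).

(* a is in the dual line of the centre iff it vanishes on sl(3). *)
Definition centrally_linearizable (c : K) (pi2 : mvfield K 9) : Prop :=
  exists a : 'rV[K]_9,
    [/\ forall k : 'I_8, a 0 (lift ord0 k) = 0,
        a != 0,
        vanishes_at pi2 a &
        schouten (const_field a) pi2 = pi1 c].

Definition Xtilde (b : 'rV[K]_10) (Q : {mpoly K[8]}) : mvfield K 9 :=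
  lift_field (Xb b) + wedge (mvfun (lift_poly Q)) d0 - wedge (mvfun x0) E.

End GL3.

(* Main.v *)
Require Import Defs.
From HB Require Import structures.
From mathcomp Require Import all_boot all_order all_algebra.
From mathcomp Require Import mpoly complex reals.
From mathcomp Require Import ring zify.
Import GRing.Theory.
Local Open Scope ring_scope.
Set Implicit Arguments.
Unset Strict Implicit.
Unset Printing Implicit Defensive.

(** Write p for the Lie-Poisson bivector of sl(3), t for the central coordinate x_0 and d for the
    derivation along it; let A = [X_b, p] and let H = [p, Q] be the Hamiltonian vector field of Q.

    The centre has zero brackets, so the Lie-Poisson bivector of gl(3) is p itself, whatever the
    scale of x_0 (pi1E).  Since p has linear coefficients, [E, p] = - p, and the Leibniz rule gives
    pi_2 = A - H /\ d + t p (bracket_Xtilde).  The degree of pi_2, the homogeneity of its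
    coefficients, its vanishing on the central line and the equality of its derivative along that
    line with p are read off from this formula.

    For the Poisson property, expand [pi_2, pi_2] by the Leibniz rule (neg_ad_pencil).  The
    hypothesis [A, A] = 2 H /\ p cancels against the cross term of H /\ d with t p, in which d
    differentiates t.  Every other term contains [p, p], [p, A], [p, H] or [A, H], a derivative
    of A, H or p along the central line, or the factor d twice.  The first three brackets vanish
    because [p, p] = 0, by the Jacobi identity of sl(3) (sl3_poisson), so that [p, -] squares to
    zero (neg_ad_sq).

    There remains [A, H] = 0 (tangent_of_square).  The Jacobi identity [A, [A, A]] = 0
    (neg_ad_cube) gives [A, H /\ p] = 0, that is [A, H] /\ p = 0, because [A, p] = 0.  But the
    wedge product with p is injective on bivectors (bivector_wedge_inj).  Indeed, let i_u denote
    the contraction with a covector u.  If B /\ p = 0, then i_u B /\ p + B /\ i_u p = 0, and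
    multiplying by p gives i_u B /\ p /\ p = 0; a second contraction, followed by a second
    multiplication by p, gives B(u, v) p /\ p /\ p = 0.  Now p /\ p /\ p is not zero: at a
    diagonal matrix with distinct eigenvalues, p is a sum of three decomposable bivectors, one for
    each pair of opposite roots, in six independent directions (P_cube_neq0).

    All computations take place in the algebra of polynomials in the even coordinates X_i and the
    odd coordinates xi_i = d/dX_i, where the wedge product is the multiplication and the Schouten
    bracket is the canonical odd Poisson bracket (bracketE).  Leibniz and Jacobi identities then
    become short manipulations of sums, in which the terms that are antisymmetric in two summation
    indices cancel. *)

(** * Signs of shuffles *)

Section Signs.
Variable n : nat.
Implicit Types (A B C I : {set 'I_n}) (i : 'I_n).

(** As a double sum, the number of inversions is biadditive for disjoint unions; all the sign rules
    below come from this and from [inversions_swap]. *)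
Lemma inversionsE A B :
  inversions A B = (\sum_(a in A) \sum_(b in B) (b < a))%N.
Proof.
rewrite /inversions pair_big_dep /= -sum1dep_card big_mkcond [RHS]big_mkcond.
by apply: eq_bigr => -[a b] _ /=; case: (a \in A); case: (b \in B); case: (b < a)%N.
Qed.

Lemma inversionsUl A B C :
  [disjoint A & B] -> inversions (A :|: B) C = (inversions A C + inversions B C)%N.
Proof.
move=> dAB; rewrite !inversionsE -bigU //=.
by apply: eq_bigl => a; rewrite !inE.
Qed.

Lemma inversionsUr A B C :
  [disjoint B & C] -> inversions A (B :|: C) = (inversions A B + inversions A C)%N.
Proof.
move=> dBC; rewrite !inversionsE -big_split /=.
apply: eq_bigr => a _; rewrite -bigU //=.
by apply: eq_bigl => b; rewrite !inE.
Qed.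

(** Each pair in A x B is an inversion in exactly one of the two orders: this is the sign of
    supercommutativity. *)
Lemma inversions_swap A B :
  [disjoint A & B] -> (inversions A B + inversions B A = #|A| * #|B|)%N.
Proof.
move=> dAB; rewrite (inversionsE B) exchange_big inversionsE -big_split /=.
rewrite -[X in (X * _)%N]sum1_card big_distrl /=; apply: eq_bigr => a aA.
rewrite mul1n -sum1_card -big_split /=; apply: eq_bigr => b bB.
by case: ltngtP => // /val_inj ab; rewrite -ab (disjointFl dAB bB) in aA.
Qed.

Lemma inversions0l A : inversions set0 A = 0%N.
Proof. by rewrite inversionsE big_set0. Qed.

Lemma inversions0r A : inversions A set0 = 0%N.
Proof. by rewrite inversionsE big1 // => a _; rewrite big_set0. Qed.

Lemma inversions1l i A : inversions [set i] A = #|[set a in A | (a < i)%N]|.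
Proof.
rewrite inversionsE big_set1 -sum1dep_card [RHS]big_mkcondr.
by apply: eq_bigr => a _; case: ltnP.
Qed.

Lemma inversions1r i A : inversions A [set i] = #|[set a in A | (i < a)%N]|.
Proof.
rewrite inversionsE -sum1dep_card [RHS]big_mkcondr.
by apply: eq_bigr => a _; rewrite big_set1; case: ltnP.
Qed.

End Signs.

(** * The wedge product as a ring multiplication *)

(** Proves equalities and disjointness of finite sets by membership, with the inclusions in the
    context as hypotheses. *)
Ltac set_tac :=
  rewrite -?setI_eq0;
  lazymatch goal with |- is_true _ => apply/eqP | _ => idtac end;
  let z := fresh "z" in apply/setP; intro z;
  repeat match goal with
  | H : is_true (?A \subset ?B) |- _ =>
      generalize (introT implyP (subsetP H z)); clear H
  end;
  rewrite !inE; repeat case: (z \in _); by [].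

Section Ring.
Variables (K : fieldType) (n : nat).

(** The type of multivector fields has a pointwise product from its function type; this copy is
    the one whose product is the wedge product. *)
Definition multivector : Type := mvfield K n.

HB.instance Definition _ := GRing.Lmodule.copy multivector (mvfield K n).

Implicit Types (R Q S T : multivector) (f g : {mpoly K[n]}) (i j : 'I_n)
  (I J A B : {set 'I_n}).

Lemma wedgeE R Q I :
  wedge R Q I = \sum_(A : {set 'I_n} | A \subset I)
     (-1) ^+ inversions A (I :\: A) * (R A * Q (I :\: A)).
Proof. by rewrite ffunE. Qed.

(** Both sides are sums over the splittings of I into three blocks A, B, C, with the sign
    inv(A, B) + inv(A, C) + inv(B, C). *)
Fact wedgeA : associative (@wedge K n : multivector -> multivector -> multivector).
Proof.
move=> R Q S; apply/ffunP => I; rewrite !wedgeE.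
pose F A C := (-1) ^+ inversions C (I :\: C) *
  ((-1) ^+ inversions A (C :\: A) * (R A * Q (C :\: A)) * S (I :\: C)).
transitivity (\sum_(C : {set 'I_n} | C \subset I)
    \sum_(A : {set 'I_n} | A \subset C) F A C);
  last by apply: eq_bigr => C _; rewrite wedgeE mulr_suml mulr_sumr.
rewrite (exchange_big_dep (fun A => A \subset I)) /=; last first.
  by move=> C A sCI sAC; apply: subset_trans sAC sCI.
apply: eq_bigr => A sAI.
rewrite (reindex_onto (fun B => A :|: B) (fun C => C :\: A)) /=; last first.
  by move=> C /andP[_ sAC]; set_tac.
rewrite wedgeE !mulr_sumr; apply: eq_big => [B|B sBI].
  apply/idP/andP => [BIA|[/andP[ABI _] /eqP <-]]; last exact: setSD.
  split; last by apply/eqP; set_tac.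
  rewrite subsetUl andbT subUset sAI; apply: subset_trans BIA _; exact: subsetDl.
rewrite /F.
have -> : (A :|: B) :\: A = B by set_tac.
have -> : I :\: A :\: B = I :\: (A :|: B) by rewrite setDDl.
set C := I :\: (A :|: B).
have -> : I :\: A = B :|: C by rewrite /C; set_tac.
rewrite inversionsUr ?inversionsUl; [|by set_tac|by rewrite /C; set_tac].
rewrite !exprD; ring.
Qed.

Definition mv1 : multivector := mvfun 1.

Lemma mvfunM f R I : wedge (mvfun f) R I = f * R I.
Proof.
rewrite wedgeE (bigD1 set0) ?sub0set //= big1 => [|A /andP[_ A0]].
  by rewrite addr0 inversions0l expr0 mul1r ffunE eqxx setD0.
by rewrite ffunE (negPf A0) mul0r mulr0.
Qed.

Lemma mvMfun f R I : wedge R (mvfun f) I = R I * f.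
Proof.
rewrite wedgeE (bigD1 I) ?subxx //= big1 => [|A /andP[sAI nsAI]].
  by rewrite addr0 setDv inversions0r expr0 mul1r ffunE eqxx.
by rewrite ffunE setD_eq0 [_ \subset _](negPf _) ?mulr0 //;
   apply: contra nsAI => IA; rewrite eqEsubset sAI.
Qed.

Fact wedge1l : left_id mv1 (@wedge K n).
Proof. by move=> R; apply/ffunP => I; rewrite mvfunM mul1r. Qed.
Fact wedge1r : right_id mv1 (@wedge K n).
Proof. by move=> R; apply/ffunP => I; rewrite mvMfun mulr1. Qed.
Fact wedgeDl : left_distributive (@wedge K n : multivector -> _) +%R.
Proof.
move=> R Q S; apply/ffunP => I; rewrite wedgeE [RHS]ffunE !wedgeE -big_split /=.
by apply: eq_bigr => A _; rewrite ffunE mulrDl mulrDr.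
Qed.
Fact wedgeDr : right_distributive (@wedge K n : multivector -> _) +%R.
Proof.
move=> R Q S; apply/ffunP => I; rewrite wedgeE [RHS]ffunE !wedgeE -big_split /=.
by apply: eq_bigr => A _; rewrite ffunE mulrDr mulrDr.
Qed.

HB.instance Definition _ := GRing.Zmodule_isPzRing.Build multivector
  wedgeA wedge1l wedge1r wedgeDl wedgeDr.

Lemma mulE R Q : R * Q = wedge R Q. Proof. by []. Qed.

End Ring.

(** * Derivatives in the even and odd coordinates *)

Section Ops.
Variables (K : fieldType) (n : nat).
Notation mv := (multivector K n).
Implicit Types (R Q S T : mv) (f g : {mpoly K[n]}) (i j : 'I_n)
  (I J A B : {set 'I_n}).

(** The parity involution, which is the sign picked up by R when an odd symbol moves across it. *)
Definition rho R : mv := [ffun I : {set 'I_n} => (-1) ^+ #|I| * R I].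
Definition dxi i R : mv := lodd i R.
Definition dx i R : mv := mvderiv i R.
(** Functions and coordinate fields as elements of the superalgebra: the even and the odd
    generators. *)
Definition fn f : mv := mvfun f.
Definition xi i : mv := partial K i.
Definition bracket R Q : mv := schouten R Q.

Lemma mv_mulE R Q I :
  (R * Q) I = \sum_(A : {set 'I_n} | A \subset I)
     (-1) ^+ inversions A (I :\: A) * (R A * Q (I :\: A)).
Proof. exact: wedgeE. Qed.

Lemma mv_sumE (J : finType) (p : pred J) (F : J -> mv) I :
  (\sum_(j | p j) F j) I = \sum_(j | p j) F j I.
Proof.
by elim/big_rec2: _ => [|j y z _ <-]; rewrite ffunE.
Qed.

Lemma mv_addE R Q I : (R + Q) I = R I + Q I. Proof. by rewrite ffunE. Qed.
Lemma mv_0E I : (0 : mv) I = 0. Proof. by rewrite ffunE. Qed.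
Lemma mv_oppE R I : (- R) I = - R I. Proof. by rewrite ffunE. Qed.

Lemma rhoE R I : rho R I = (-1) ^+ #|I| * R I. Proof. by rewrite ffunE. Qed.
Lemma dxE i R I : dx i R I = (R I)^`M(i). Proof. by rewrite ffunE. Qed.

Lemma dxiE i R I :
  dxi i R I = if i \in I then 0 else (-1) ^+ inversions [set i] I * R (i |: I).
Proof. by rewrite ffunE inversions1l. Qed.

Fact rho_additive : zmod_morphism rho.
Proof. by move=> R Q; apply/ffunP => I; rewrite !ffunE mulrBr. Qed.
HB.instance Definition _ := GRing.isZmodMorphism.Build mv mv rho rho_additive.

Fact dxi_additive i : zmod_morphism (dxi i).
Proof.
move=> R Q; apply/ffunP => I; rewrite !(dxiE, ffunE).
by case: ifP; rewrite ?subr0 ?mulrBr // oppr0.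
Qed.
HB.instance Definition _ i := GRing.isZmodMorphism.Build mv mv (dxi i) (dxi_additive i).

Fact dx_additive i : zmod_morphism (dx i).
Proof. by move=> R Q; apply/ffunP => I; rewrite !ffunE mderivB. Qed.
HB.instance Definition _ i := GRing.isZmodMorphism.Build mv mv (dx i) (dx_additive i).

Fact fn_additive : zmod_morphism fn.
Proof. by move=> f g; apply/ffunP => I; rewrite !ffunE; case: ifP; rewrite ?subr0. Qed.
HB.instance Definition _ := GRing.isZmodMorphism.Build _ mv fn fn_additive.

Lemma fnME f R I : (fn f * R) I = f * R I. Proof. exact: mvfunM. Qed.
Lemma Mfn f R : R * fn f = fn f * R.
Proof. by apply/ffunP => I; rewrite fnME mulE mvMfun mulrC. Qed.
Lemma fnM f g : fn (f * g) = fn f * fn g.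
Proof. by apply/ffunP => I; rewrite fnME !ffunE; case: ifP; rewrite ?mulr0. Qed.
Lemma fn1 : fn 1 = 1. Proof. by []. Qed.

Lemma dxM i R Q : dx i (R * Q) = dx i R * Q + R * dx i Q.
Proof.
apply/ffunP => I; rewrite dxE mv_addE !mv_mulE raddf_sum -big_split.
apply: eq_bigr => A sAI; rewrite !dxE /=.
rewrite -signr_odd; case: (odd _); rewrite ?expr0 ?expr1 ?mul1r ?mulN1r ?mderivN mderivM;
  ring.
Qed.

(** The derivative in an odd coordinate is an odd derivation.  Writing the products over splittings
    of I, with I containing i, the two terms on the right cancel in pairs (i moves from one block to
    the other); if I does not contain i, they correspond to the splittings of I with i added to
    the left or to the right block. *)
Lemma dxiM i R Q : dxi i (R * Q) = dxi i R * Q + rho R * dxi i Q.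
Proof.
apply/ffunP => I; rewrite dxiE mv_addE !mv_mulE.
have sgn2 k : (-1) ^+ k * (-1) ^+ k = 1 :> {mpoly K[n]}.
  by rewrite -expr2 sqrr_sign.
have sgn1 A : i \notin A -> (-1) ^+ inversions A [set i] =
   (-1) ^+ #|A| * (-1) ^+ inversions [set i] A :> {mpoly K[n]}.
  move=> iA; rewrite -[#|A|]mul1n -(cards1 i) -inversions_swap ?disjoints1 //.
  by rewrite exprD mulrAC sgn2 mul1r.
have subU1 A : i \notin A -> (A \subset i |: I) = (A \subset I).
  by move=> iA; rewrite -subDset (setDidPl _) // disjoint_sym disjoints1.
case: ifPn => iI.
- rewrite [X in X + _](bigID (fun A => i \in A)) [X in _ + X](bigID (fun A => i \notin A)) /=.
  rewrite [X in X + _ + _]big1; last first.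
    by move=> A /andP[_ iA]; rewrite dxiE iA mul0r mulr0.
  rewrite [X in _ + (X + _)]big1; last first.
    by move=> A /andP[_ iA]; rewrite dxiE inE iA iI !mulr0.
  rewrite !add0r.
  rewrite [X in _ + X](reindex_onto (fun A => i |: A) (fun A => A :\ i)) /=; last first.
    by move=> A; rewrite negbK => /andP[_ iA]; rewrite setD1K.
  symmetry; apply/eqP; rewrite addr_eq0 -sumrN; apply/eqP.
  apply: eq_big => [A|A /andP[sAI iA]].
    rewrite subUset sub1set iI setU11 /=; case: (A \subset I) => //=.
    case: (boolP (i \in A)) => iA; last by rewrite setU1K ?eqxx.
    by apply/esym/negbTE/eqP => e; rewrite -e !inE eqxx in iA.
  have [B [iB -> ->]] : exists B, [/\ i \notin B, I :\: A = i |: B & I :\: (i |: A) = B].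
    exists (I :\: (i |: A)); split=> //; first by rewrite !inE eqxx.
    apply/setP => z; rewrite !inE; case: eqP => //= ->; by rewrite iA.
  rewrite inversionsUr ?inversionsUl ?disjoints1 // !dxiE (negPf iA) (negPf iB) rhoE cardsU1 iA.
  rewrite !exprD sgn1 //= expr1.
  move: (sgn2 #|A|) (sgn2 (inversions [set i] A)) (sgn2 (inversions [set i] B)).
  move: ((-1) ^+ #|A|) ((-1) ^+ (inversions [set i] A)) ((-1) ^+ (inversions [set i] B)).
  move=> a b d a2 b2 d2.
  transitivity (a * (b * b) * ((-1) ^+ inversions A B * (R (i |: A) * Q (i |: B)))); first by ring.
  transitivity (a * (d * d) * ((-1) ^+ inversions A B * (R (i |: A) * Q (i |: B)))); last by ring.
  by rewrite b2 d2.
- rewrite (bigID (fun A => i \in A)) /= mulrDr; congr (_ + _).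
    rewrite (reindex_onto (fun A => i |: A) (fun A => A :\ i)) /=; last first.
      by move=> A /andP[_ iA]; rewrite setD1K.
    rewrite mulr_sumr; apply: eq_big => [A|A /andP[/andP[sA _] /eqP eA]].
      rewrite setU11 andbT subUset sub1set setU11 /=.
      apply/andP/idP => [[sA /eqP eA]|sAI].
        by rewrite -eA subDset subUset subsetUl.
      split; first by rewrite subsetU // sAI orbT.
      by rewrite setU1K //; apply: contra iI; apply: subsetP.
    have iA : i \notin A by rewrite -eA !inE eqxx.
    have sAI : A \subset I by rewrite -eA subDset.
    have -> : (i |: I) :\: (i |: A) = I :\: A.
      apply/setP => z; rewrite !inE; case: eqP => [->|] //=; by rewrite (negPf iI) andbF.
    rewrite dxiE (negPf iA) inversionsUl ?disjoints1 //.
    have {1}-> : I = A :|: (I :\: A) by set_tac.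
    rewrite inversionsUr; last by set_tac.
    rewrite !exprD.
    move: (sgn2 (inversions [set i] (I :\: A))).
    move: ((-1) ^+ (inversions [set i] (I :\: A))) => d d2.
    rewrite -[RHS]mul1r -d2; ring.
  rewrite mulr_sumr; apply: eq_big => [A|A /andP[sA iA]].
    apply/andP/idP => [[sA iA]|sAI].
      by rewrite -(subU1 A iA).
    split; first by rewrite subsetU // sAI orbT.
    by apply: contra iI; apply: subsetP.
  have sAI : A \subset I by rewrite -(subU1 A iA).
  have -> : (i |: I) :\: A = i |: (I :\: A).
    apply/setP => z; rewrite !inE; case: eqP => [->|] //=; by rewrite (negPf iA).
  have iD : i \notin I :\: A by rewrite !inE negb_and iI orbT.
  rewrite dxiE (negPf iD) rhoE inversionsUr ?disjoints1 //.
  have {1}-> : I = A :|: (I :\: A) by set_tac.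
  rewrite inversionsUr; last by set_tac.
  rewrite !exprD sgn1 //.
  move: (sgn2 (inversions [set i] A)).
  move: ((-1) ^+ (inversions [set i] A)) => d d2.
  rewrite -[RHS]mul1r -d2; ring.
Qed.
End Ops.

(** * Supercommutativity and degrees *)

Section Ops2.
Variables (K : fieldType) (n : nat).
Notation mv := (multivector K n).
Implicit Types (R Q S T : mv) (f g : {mpoly K[n]}) (i j : 'I_n)
  (I J A B : {set 'I_n}).

(** Moving the odd variable to the back instead of the front costs the parity sign of the remaining
    factors, so right derivatives reduce to left ones. *)
Lemma bracketE R Q :
  bracket R Q = \sum_i (rho (dxi i R) * dx i Q - dx i R * dxi i Q).
Proof.
apply: eq_bigr => i _; congr (wedge _ _ - _); apply/ffunP => I.
rewrite rhoE dxiE ffunE; case: ifPn => iI; first by rewrite mulr0.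
rewrite mulrA -inversions1r; congr (_ * _).
rewrite -[#|I|]mul1n -(cards1 i) -inversions_swap ?disjoints1 // exprD mulrAC.
by rewrite -expr2 sqrr_sign mul1r.
Qed.

Lemma dx_dxi i j R : dx i (dxi j R) = dxi j (dx i R).
Proof.
apply/ffunP => I; rewrite dxE !dxiE dxE; case: ifP => _; first by rewrite mderiv0.
by rewrite -signr_odd; case: (odd _); rewrite ?expr0 ?expr1 ?mul1r ?mulN1r ?mderivN.
Qed.

Lemma dx_dx i j R : dx i (dx j R) = dx j (dx i R).
Proof. by apply/ffunP => I; rewrite !dxE mderiv_comm. Qed.

Lemma dxi_dxi i j R : dxi i (dxi j R) = - dxi j (dxi i R).
Proof.
apply/ffunP => I; rewrite mv_oppE !dxiE !inE.
case: (altP (i =P j)) => [<-|nij]; first by rewrite eqxx mulr0; case: ifP; rewrite oppr0.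
rewrite [j == i]eq_sym (negPf nij) /=.
case: ifPn => iI; case: ifPn => jI; rewrite ?(mulr0, oppr0) //.
rewrite !inversionsUr ?disjoints1 // setUCA !exprD.
have : (inversions [set i] [set j] + inversions [set j] [set i] = 1)%N.
  by rewrite inversions_swap ?cards1 // disjoints1 inE.
move: (inversions [set i] [set j]) (inversions [set j] [set i]).
by move=> [|[|a]] [|[|b]] // _; ring.
Qed.

Lemma dxi_fn i f : dxi i (fn f) = 0.
Proof.
apply/ffunP => I; rewrite dxiE !ffunE; case: ifP => // _.
by rewrite setU_eq0 -cards_eq0 cards1 mulr0.
Qed.

Lemma dxi_xi i j : dxi i (xi K j) = (i == j)%:R.
Proof.
apply/ffunP => I; rewrite dxiE.
have -> : (i == j)%:R = fn (i == j)%:R :> mv.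
  by case: (i == j); rewrite ?mulr0n ?mulr1n ?raddf0.
rewrite !ffunE; case: ifPn => iI.
  by case: eqP => // I0; rewrite I0 inE in iI.
have -> : (i |: I == [set j]) = (i == j) && (I == set0).
  apply/eqP/andP => [e|[/eqP -> /eqP ->]]; last by rewrite setU0.
  have ij : i == j by rewrite -in_set1 -e setU11.
  by rewrite -(setU1K iI) e (eqP ij) setDv !eqxx.
case: (I =P set0) => [->|]; rewrite ?andbF ?mulr0 //.
by rewrite inversions0r mul1r andbT.
Qed.

Lemma dx_xi i j : dx i (xi K j) = 0.
Proof.
apply/ffunP => I; rewrite dxE !ffunE; case: eqP => _ ; last exact: mderiv0.
by rewrite -[1%:R]/1 -mpolyC1 mderivC.
Qed.

Lemma dx_fn i f : dx i (fn f) = fn f^`M(i).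
Proof. by apply/ffunP => I; rewrite dxE !ffunE; case: ifP; rewrite ?mderiv0. Qed.

(** The number of odd variables; the zero field has every degree. *)
Definition deg d R := [forall I, (R I != 0) ==> (#|I| == d)].

Lemma degP d R : reflect (forall I, R I != 0 -> #|I| = d) (deg d R).
Proof.
apply: (iffP forallP) => dR I; last by apply/implyP => /dR/eqP.
by move/implyP: (dR I) => h /h/eqP.
Qed.

Lemma deg_eq0 d R I : deg d R -> #|I| != d -> R I = 0.
Proof. by move=> /degP dR; apply: contraNeq => /dR ->. Qed.

Lemma deg0 d : deg d 0. Proof. by apply/degP => I; rewrite ffunE eqxx. Qed.

Lemma degD d R Q : deg d R -> deg d Q -> deg d (R + Q).
Proof.
move=> dR dQ; apply/degP => I; rewrite mv_addE; apply: contraNeq => nI.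
by rewrite (deg_eq0 dR) ?(deg_eq0 dQ) ?addr0.
Qed.

Lemma degN d R : deg d R -> deg d (- R).
Proof. by move=> /degP dR; apply/degP => I; rewrite mv_oppE oppr_eq0 => /dR. Qed.

Lemma degB d R Q : deg d R -> deg d Q -> deg d (R - Q).
Proof. by move=> dR dQ; apply: degD => //; apply: degN. Qed.

Lemma deg_sum d (V : Type) (r : seq V) (p : pred V) (F : V -> mv) :
  (forall v, p v -> deg d (F v)) -> deg d (\sum_(v <- r | p v) F v).
Proof. move=> dF; apply: (big_ind (fun R => deg d R)) => //; [exact: deg0|exact: degD]. Qed.

Lemma degZ d (a : K) R : deg d R -> deg d (a *: R).
Proof.
move=> dR; apply/degP => I; rewrite ffunE; apply: contraNeq => nI.
by rewrite (deg_eq0 dR) ?scaler0.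
Qed.

Lemma deg_fn f : deg 0 (fn f).
Proof. by apply/degP => I; rewrite ffunE; case: (I =P _) => [->|_]; rewrite ?cards0 ?eqxx. Qed.

Lemma deg_xi i : deg 1 (xi K i).
Proof. by apply/degP => I; rewrite ffunE; case: (I =P _) => [->|_]; rewrite ?cards1 ?eqxx. Qed.

Lemma degM a b R Q : deg a R -> deg b Q -> deg (a + b) (R * Q).
Proof.
move=> /degP dR /degP dQ; apply/degP => I; rewrite mv_mulE; apply: contraNeq => nI.
rewrite big1 // => A sAI; apply/eqP; rewrite mulf_eq0; apply/orP; right.
rewrite mulf_eq0; apply: contraR nI; rewrite negb_or => /andP[/dR <- /dQ <-].
by rewrite -(cardsID A I) (setIidPr sAI).
Qed.

Lemma deg_dx i d R : deg d R -> deg d (dx i R).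
Proof.
by move=> dR; apply/degP => I; rewrite dxE; apply: contraNeq => nI; rewrite (deg_eq0 dR) ?mderiv0.
Qed.

Lemma deg_dxi i d R : deg d R -> deg d.-1 (dxi i R).
Proof.
move=> /degP dR; apply/degP => I; rewrite dxiE; case: ifPn => [_|iI]; first by rewrite eqxx.
by rewrite mulf_eq0 negb_or => /andP[_ /dR <-]; rewrite cardsU1 iI.
Qed.

Lemma deg_rho d R : deg d R -> deg d (rho R).
Proof. by move=> /degP dR; apply/degP => I; rewrite rhoE mulf_eq0 negb_or => /andP[_ /dR]. Qed.

Lemma dxi_deg0 i R : deg 0 R -> dxi i R = 0.
Proof.
move=> dR; apply/ffunP => I; rewrite dxiE ffunE; case: ifPn => // iI.
by rewrite (deg_eq0 dR) ?mulr0 // cardsU1 iI.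
Qed.

Lemma deg_bracket a b R Q : deg a R -> deg b Q -> deg (a + b).-1 (bracket R Q).
Proof.
move=> dR dQ; rewrite bracketE; apply: deg_sum => i _; apply: degB.
  case: a dR => [|a] dR; first by rewrite (dxi_deg0 i dR) raddf0 mul0r; exact: deg0.
  by apply: (@degM a b); [exact: deg_rho (deg_dxi i dR)|exact: deg_dx].
case: b dQ => [|b] dQ; first by rewrite (dxi_deg0 i dQ) mulr0; exact: deg0.
by rewrite addnS; apply: degM; [exact: deg_dx|exact: (deg_dxi i dQ)].
Qed.

Lemma rho_deg d R : deg d R -> rho R = if odd d then - R else R.
Proof.
move=> dR; apply/ffunP => I; rewrite rhoE.
have [I0|/(degP _ _ dR) <-] := eqVneq (R I) 0.
  by case: (odd d); rewrite ?mv_oppE I0 mulr0 ?oppr0.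
by rewrite -signr_odd; case: odd; rewrite ?expr0 ?expr1 ?mul1r ?mulN1r ?mv_oppE.
Qed.

(** Exchanging the two blocks of each splitting changes the sign by the product of their sizes. *)
Lemma supercomm d R Q : deg d R -> R * Q = (if odd d then rho Q else Q) * R.
Proof.
move=> dR; apply/ffunP => I; rewrite !mv_mulE.
rewrite [LHS](reindex_onto (fun A => I :\: A) (fun A => I :\: A)) /=; last first.
  by move=> A sAI; set_tac.
apply: eq_big => [A|A /andP[_ /eqP eA]].
  rewrite subsetDl /=; apply/eqP/idP => [<-|sAI]; first exact: subsetDl.
  by set_tac.
have sAI : A \subset I by rewrite -eA subsetDl.
rewrite eA; have [->|/(degP _ _ dR) dRA] := eqVneq (R (I :\: A)) 0.
  by rewrite !(mul0r, mulr0).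
have /inversions_swap : [disjoint I :\: A & A] by set_tac.
rewrite dRA => e.
have -> : (-1) ^+ inversions (I :\: A) A =
    (-1) ^+ inversions A (I :\: A) * (-1) ^+ (d * #|A|) :> {mpoly K[n]}.
  by rewrite -e exprD mulrCA -expr2 sqrr_sign mulr1.
rewrite exprM -[(-1) ^+ d]signr_odd; case: (odd d); last by rewrite expr1n; ring.
rewrite rhoE; ring.
Qed.
End Ops2.

(** * The Schouten bracket with a bivector *)

Section Schouten.
Variables (K : fieldType) (n : nat).
Hypothesis charK : [pchar K] =i pred0.
Notation mv := (multivector K n).
Implicit Types (A B P Q R S X : mv) (f g : {mpoly K[n]}) (i j : 'I_n).

Lemma mv_natmul_eq0 k R : R *+ k.+1 = 0 -> R = 0.
Proof.
rewrite -scaler_nat => /eqP; rewrite scaler_eq0 => /orP[|/eqP //].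
by rewrite ((pcharf0P K).1 charK).
Qed.

Lemma deg2C A R : deg 2 A -> A * R = R * A. Proof. by move/supercomm->. Qed.
Lemma deg1C A R : deg 1 A -> A * R = rho R * A. Proof. by move/supercomm->. Qed.
Lemma deg1N A B : deg 1 A -> deg 1 B -> A * B = - (B * A).
Proof. by move=> dA dB; rewrite (deg1C _ dA) (rho_deg dB) mulNr. Qed.
Lemma deg1_sq A : deg 1 A -> A * A = 0.
Proof.
move=> dA; apply: (@mv_natmul_eq0 1); rewrite mulr2n {1}(deg1N dA dA); exact: addNr.
Qed.

Lemma antisym_sum (F : 'I_n -> 'I_n -> mv) :
  (forall i j, F i j = - F j i) -> \sum_i \sum_j F i j = 0.
Proof.
move=> FN; apply: (@mv_natmul_eq0 1); rewrite mulr2n {1}exchange_big -big_split.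
by rewrite big1 // => i _; rewrite -big_split big1 // => j _; rewrite /= FN addNr.
Qed.

(** For an even A the Schouten bracket with A is the opposite of this operator ([bracket_deg2]),
    which is symmetric in its arguments on bivectors. *)
Definition neg_ad A Q : mv := \sum_i (dxi i A * dx i Q + dx i A * dxi i Q).

Lemma bracket_deg2 A Q : deg 2 A -> bracket A Q = - neg_ad A Q.
Proof.
move=> dA; rewrite bracketE -sumrN; apply: eq_bigr => i _.
by rewrite (rho_deg (deg_dxi i dA)) mulNr opprD.
Qed.

Lemma bracket_deg1 X A : deg 1 X -> deg 2 A -> bracket X A = neg_ad A X.
Proof.
move=> dX dA; rewrite bracketE; apply: eq_bigr => i _.
rewrite (rho_deg (deg_dxi i dX)) /= addrC -(deg2C _ (deg_dx i dA)).
by rewrite (deg1N (deg_dx i dX) (deg_dxi i dA)) opprK.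
Qed.

Lemma neg_ad_sym A B : deg 2 A -> deg 2 B -> neg_ad A B = neg_ad B A.
Proof.
move=> dA dB; apply: eq_bigr => i _.
by rewrite addrC (deg2C _ (deg_dx i dA)) -(deg2C _ (deg_dx i dB)).
Qed.

(** The Leibniz rule of the bracket with a bivector, an odd derivation. *)
Lemma neg_adM A Q S : deg 2 A -> neg_ad A (Q * S) = neg_ad A Q * S + rho Q * neg_ad A S.
Proof.
move=> dA; rewrite mulr_suml mulr_sumr -big_split; apply: eq_bigr => i _ /=.
rewrite dxM dxiM !mulrDr !mulrDl !mulrA.
by rewrite (deg1C Q (deg_dxi i dA)) (deg2C (rho Q) (deg_dx i dA)) addrACA.
Qed.

Lemma neg_adBl A B Q : neg_ad (A - B) Q = neg_ad A Q - neg_ad B Q.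
Proof.
rewrite -sumrB; apply: eq_bigr => i _.
by rewrite !raddfB /= !mulrBl opprD addrACA.
Qed.
Lemma neg_adDl A B Q : neg_ad (A + B) Q = neg_ad A Q + neg_ad B Q.
Proof.
rewrite -big_split; apply: eq_bigr => i _.
by rewrite !raddfD /= !mulrDl addrACA.
Qed.
Lemma neg_adDr A Q S : neg_ad A (Q + S) = neg_ad A Q + neg_ad A S.
Proof.
rewrite -big_split; apply: eq_bigr => i _.
by rewrite !raddfD /= !mulrDr addrACA.
Qed.
Lemma neg_adNr A Q : neg_ad A (- Q) = - neg_ad A Q.
Proof.
rewrite -sumrN; apply: eq_bigr => i _.
by rewrite !raddfN /= !mulrN opprD.
Qed.
Lemma neg_adBr A Q S : neg_ad A (Q - S) = neg_ad A Q - neg_ad A S.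
Proof. by rewrite neg_adDr neg_adNr. Qed.

Lemma neg_ad_self A : deg 2 A -> neg_ad A A = (\sum_i dxi i A * dx i A) *+ 2.
Proof.
move=> dA; rewrite mulr2n -big_split; apply: eq_bigr => i _.
by rewrite (deg2C _ (deg_dx i dA)).
Qed.

(** The Jacobi identity [A, [A, A]] = 0.  Among the second-order terms of the double sum, F2 and F3
    pair a symmetric factor with an antisymmetric one, and F1 and F4 agree up to exchanging the
    indices. *)
Lemma neg_ad_cube A : deg 2 A -> neg_ad A (neg_ad A A) = 0.
Proof.
move=> dA.
have da i := deg_dx i dA; have dx1 i := deg_dxi i dA.
rewrite (neg_ad_self dA) mulr2n neg_adDr.
suff -> : neg_ad A (\sum_j dxi j A * dx j A) = 0 by rewrite addr0.
pose F1 i j := dxi i A * dx i (dxi j A) * dx j A.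
pose F2 i j := dxi i A * dxi j A * dx i (dx j A).
pose F3 i j := dx i A * dxi i (dxi j A) * dx j A.
pose F4 i j := dx i A * dxi j A * dxi i (dx j A).
transitivity (\sum_i \sum_j (F1 i j + F2 i j + F3 i j - F4 i j)).
  apply: eq_bigr => i _; rewrite !raddf_sum !mulr_sumr -big_split.
  apply: eq_bigr => j _ /=; rewrite dxM dxiM (rho_deg (dx1 j)) /= !mulrDr mulNr mulrN.
  by rewrite !mulrA addrA.
under eq_bigr do rewrite sumrB !big_split /=.
rewrite sumrB !big_split /=.
rewrite [X in _ + X + _ - _]antisym_sum; last first.
  by move=> i j; rewrite /F2 (deg1N (dx1 i) (dx1 j)) mulNr dx_dx.
rewrite [X in _ + _ + X - _]antisym_sum; last first.
  move=> i j; rewrite /F3 dxi_dxi mulrN mulNr; congr (- _).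
  rewrite (deg2C _ (da i)) -(deg2C _ (da j)) mulrA; congr (_ * _).
rewrite !addr0; apply/eqP; rewrite subr_eq0 exchange_big; apply/eqP.
apply: eq_bigr => i _; apply: eq_bigr => j _.
by rewrite /F1 /F4 -(deg2C _ (da i)) mulrA dx_dxi.
Qed.

(** The bracket with P squares to the bracket with [P, P] / 2.  The second derivatives of Q cancel
    as in [neg_ad_cube]; the terms with a first derivative of Q add up to derivatives of the square T
    of P (F1 and F3), hence vanish. *)
Lemma neg_ad_sq P Q : deg 2 P -> neg_ad P P = 0 -> neg_ad P (neg_ad P Q) = 0.
Proof.
move=> dP; rewrite neg_ad_self // => /mv_natmul_eq0; set T := \sum_i _ => T0.
have dp i := deg_dx i dP; have dd1 i := deg_dxi i dP.
pose F1 i j := dxi i P * dx i (dxi j P) * dx j Q + dx i P * dxi i (dxi j P) * dx j Q.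
pose F2 i j := dxi i P * dxi j P * dx i (dx j Q).
pose F3 i j := dxi i P * dx i (dx j P) * dxi j Q + dx i P * dxi i (dx j P) * dxi j Q.
pose F4 i j := dxi i P * dx j P * dx i (dxi j Q).
pose F6 i j := dx i P * dxi j P * dxi i (dx j Q).
pose F8 i j := dx i P * dx j P * dxi i (dxi j Q).
have reorder (a b c d u v w z : mv) :
    a + b + (c + d) + (u + v + (w + z)) = a + u + b + (c + w) + z + (d + v).
  by rewrite !addrA [LHS](ACl (1*5*2*3*7*8*4*6)).
pose total (F : 'I_n -> 'I_n -> mv) := \sum_i \sum_j F i j.
transitivity (total F1 + total F2 + total F3 + total F8 + (total F4 - total F6)).
  rewrite /total -sumrB -!big_split; apply: eq_bigr => i _ /=.
  rewrite -sumrB -!big_split !raddf_sum !mulr_sumr -big_split.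
  apply: eq_bigr => j _ /=.
  rewrite !raddfD /= !dxM !dxiM (rho_deg (dd1 j)) (rho_deg (dp j)) /=.
  rewrite /F1 /F3 /F2 /F8 /F4 /F6 !mulrDr mulNr mulrN !mulrA.
  exact: reorder.
have -> : total F1 = 0.
  rewrite /total exchange_big big1 // => j _.
  have -> : \sum_i F1 i j = - dxi j T * dx j Q.
    rewrite raddf_sum -sumrN mulr_suml; apply: eq_bigr => i _.
    rewrite /= dxiM (rho_deg (dd1 i)) /= /F1 -mulrDl; congr (_ * _).
    by rewrite mulNr opprB dx_dxi dxi_dxi mulrN (deg2C _ (dp i)).
  by rewrite T0 raddf0 oppr0 mul0r.
have -> : total F2 = 0.
  by apply: antisym_sum => i j; rewrite /F2 (deg1N (dd1 i) (dd1 j)) mulNr dx_dx.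
have -> : total F3 = 0.
  rewrite /total exchange_big big1 // => j _.
  have -> : \sum_i F3 i j = dx j T * dxi j Q.
    rewrite raddf_sum mulr_suml; apply: eq_bigr => i _.
    by rewrite /= dxM /F3 -mulrDl addrC dx_dx (deg2C _ (dp i)) dx_dxi.
  by rewrite T0 raddf0 mul0r.
have -> : total F8 = 0.
  by apply: antisym_sum => i j; rewrite /F8 (deg2C _ (dp i)) dxi_dxi mulrN.
rewrite !add0r; apply/eqP; rewrite subr_eq0 /total exchange_big; apply/eqP.
apply: eq_bigr => i _; apply: eq_bigr => j _.
by rewrite /F4 /F6 -(deg2C _ (dp i)) dx_dxi.
Qed.

Lemma deg_neg_ad A a Q : deg 2 A -> deg a Q -> deg a.+1 (neg_ad A Q).
Proof.
by move=> dA dQ; rewrite -[neg_ad A Q]opprK -bracket_deg2 //; apply/degN/(deg_bracket dA dQ).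
Qed.

(** A field of positive degree is determined by its contractions. *)
Lemma dxi_inj d R : deg d.+1 R -> (forall i, dxi i R = 0) -> R = 0.
Proof.
move=> dR dR0; apply/ffunP => I; rewrite [RHS]ffunE.
have [I0|[i iI]] := set_0Vmem I; first by rewrite (deg_eq0 dR) // I0 cards0.
have := congr1 (fun S : mv => S (I :\ i)) (dR0 i); rewrite dxiE setD1K // !inE eqxx.
by rewrite ffunE /= => /eqP; rewrite mulf_eq0 signr_eq0 => /eqP.
Qed.

Lemma deg0E R : deg 0 R -> R = fn (R set0).
Proof.
move=> dR; apply/ffunP => I; rewrite ffunE; case: eqP => [->//|/eqP nI].
by rewrite (deg_eq0 dR) // cards_eq0.
Qed.

(** Polynomials form a domain and act on coefficients. *)
Lemma deg0_mul_eq0 R S : deg 0 R -> R * S = 0 -> S != 0 -> R = 0.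
Proof.
move=> dR; rewrite (deg0E dR) => RS0 nS.
suff -> : R set0 = 0 by rewrite raddf0.
apply/eqP; apply: contraNT nS => nR; apply/eqP/ffunP => I.
have := congr1 (fun S : mv => S I) RS0; rewrite fnME mv_0E => /eqP.
by rewrite mulf_eq0 (negPf nR) => /eqP ->.
Qed.

(** Contracting A P = 0 and multiplying by P gives v P P = 0 for v = [dxi i A]; doing the same again
    gives [dxi j v] P P P = 0, a function times a nonzero field. *)
Lemma bivector_wedge_inj A P : deg 2 A -> deg 2 P -> P * P * P != 0 -> A * P = 0 -> A = 0.
Proof.
move=> dA dP nP AP0.
apply: (dxi_inj dA) => i; have dv := deg_dxi i dA; set v := dxi i A in dv *.
have vPP : v * (P * P) = 0.
  have := congr1 (fun R => dxi i R * P) AP0.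
  rewrite dxiM raddf0 mul0r (rho_deg dA) /= mulrDl -!mulrA => <-.
  by rewrite -[X in _ + _ * X](deg2C _ dP) [A * (P * _)]mulrA AP0 mul0r addr0.
apply: (dxi_inj dv) => j; apply: deg0_mul_eq0 nP; first exact: (deg_dxi j dv).
have vdPP : v * (dxi j (P * P) * P) = 0.
  rewrite dxiM (rho_deg dP) /= -(deg2C _ dP) -(deg2C (dxi j P) dP).
  by rewrite !mulrDr !mulrA -[v * P * P]mulrA vPP !mul0r addr0.
have := congr1 (fun R => dxi j R * P) vPP.
rewrite dxiM raddf0 mul0r (rho_deg dv) /= mulrDl mulNr mulNr -!mulrA vdPP.
by rewrite oppr0 addr0 => ->.
Qed.
End Schouten.

(** * Squares of bivectors and Lie-Poisson bivectors *)

Section LiePoisson.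
Variables (K : fieldType) (n : nat).
Hypothesis charK : [pchar K] =i pred0.
Notation mv := (multivector K n).

(** The Hamiltonian field H of f preserves the bivector A = [X, P] as soon as [A, A] = 2 H /\ P:
    the derivation [A, -] kills [A, A] and P, so it maps H /\ P to [A, H] /\ P = 0. *)
Lemma tangent_of_square (X P : mv) f :
  deg 1 X -> deg 2 P -> P * P * P != 0 -> bracket P P = 0 ->
  bracket (bracket X P) (bracket X P) = (bracket P (fn f) * P) *+ 2 ->
  bracket (bracket X P) (bracket P (fn f)) = 0.
Proof.
move=> dX dP nP PP0 sq.
have dA : deg 2 (bracket X P) by exact: (deg_bracket dX dP).
have dH : deg 1 (bracket P (fn f)) by exact: (deg_bracket dP (deg_fn f)).
have ddP : neg_ad P P = 0 by apply/eqP; rewrite -oppr_eq0 -bracket_deg2 // PP0.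
have ddA : neg_ad P (bracket X P) = 0 by rewrite (bracket_deg1 dX dP); exact: neg_ad_sq.
set A := bracket X P in sq dA ddA *; set H := bracket P (fn f) in sq dH *.
rewrite (bracket_deg2 _ dA).
apply/eqP; rewrite oppr_eq0; apply/eqP.
apply: (bivector_wedge_inj (deg_neg_ad dA dH) dP nP).
have := neg_ad_cube charK dA.
rewrite -[neg_ad A A]opprK -(bracket_deg2 _ dA) sq neg_adNr mulr2n neg_adDr -mulr2n.
move/eqP; rewrite oppr_eq0 => /eqP /(mv_natmul_eq0 charK).
by rewrite (neg_adM _ _ dA) (neg_ad_sym dA dP) ddA mulr0 addr0.
Qed.

Lemma sum3_rot (V : nmodType) (F : 'I_n -> 'I_n -> 'I_n -> V) :
  \sum_k \sum_i \sum_j F k i j = \sum_k \sum_i \sum_j F i j k.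
Proof.
rewrite exchange_big; under eq_bigr do rewrite exchange_big.
by rewrite exchange_big; under eq_bigr do rewrite exchange_big.
Qed.

Lemma dxi_fnM i f (R : mv) : dxi i (fn f * R) = fn f * dxi i R.
Proof. by rewrite dxiM dxi_fn mul0r add0r (rho_deg (deg_fn f)). Qed.

Lemma xiN i j : xi K i * xi K j = - (xi K j * xi K i) :> mv.
Proof. by apply: deg1N; apply: deg_xi. Qed.

Lemma mderivXU (i j : 'I_n) : ('X_j : {mpoly K[n]})^`M(i) = (j == i)%:R.
Proof.
rewrite mderivX mnm1E; case: eqP => [->|_]; last by rewrite scale0r.
have -> : (U_(i) - U_(i) = 0)%MM by apply/mnmP => k; rewrite mnmBE mnm0E subnn.
by rewrite mpolyX0 scale1r.
Qed.

Variables (e : seq 'M[K]_3) (lin : {linear 'M[K]_3 -> {mpoly K[n]}}).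
Definition mxcomm (A B : 'M[K]_3) := A *m B - B *m A.
(** The matrices e_i span a Lie algebra, with structure constants c for each pair (i, j), and lin is
    its identification with the linear functions on the dual. *)
Hypothesis e_span : forall i j : 'I_n, exists2 c : 'I_n -> K,
  mxcomm e`_i e`_j = \sum_k c k *: e`_k &
  lin (mxcomm e`_i e`_j) = \sum_k c k *: 'X_k.

Lemma mxcommN A B : mxcomm A B = - mxcomm B A.
Proof. by rewrite opprB. Qed.

Lemma mxcomm_jacobi A B C :
  mxcomm (mxcomm A B) C + mxcomm (mxcomm B C) A + mxcomm (mxcomm C A) B = 0.
Proof.
rewrite /mxcomm !mulmxBl !mulmxBr !mulmxA !opprB.
set x1 := A *m B *m C; set x2 := B *m A *m C; set x3 := C *m A *m B.
set x4 := C *m B *m A; set x5 := B *m C *m A; set x6 := A *m C *m B.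
apply/matrixP => i j; rewrite !mxE; ring.
Qed.

Lemma lie_poissonE : lie_poisson e lin =
  \sum_(i < n) \sum_(j < n | (i < j)%N) fn (lin (mxcomm e`_i e`_j)) * (xi K i * xi K j) :> mv.
Proof. by []. Qed.

Lemma deg_lie_poisson : deg 2 (lie_poisson e lin : mv).
Proof.
apply: deg_sum => i _; apply: deg_sum => j _.
exact: (degM (deg_fn _) (degM (deg_xi K i) (deg_xi K j))).
Qed.

(** Replaces the sum over i < j in the definition of the Lie-Poisson bivector by a sum over all
    pairs, in which the indices are free. *)
Lemma sum_lt_sym (V : nmodType) (F : 'I_n -> 'I_n -> V) :
  (forall i j, F i j = F j i) -> (forall i, F i i = 0) ->
  (\sum_(i < n) \sum_(j < n | (i < j)%N) F i j) *+ 2 = \sum_(i < n) \sum_(j < n) F i j.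
Proof.
move=> Fsym F0.
rewrite mulr2n {2}(exchange_big_dep xpredT) //= -big_split.
apply: eq_bigr => i _ /=; rewrite [RHS](bigID (fun j : 'I_n => (i < j)%N)) /=.
congr (_ + _); rewrite [RHS](bigD1 i) ?ltnn //= F0 add0r.
apply: eq_big => [j|j _]; last exact: Fsym.
by rewrite -leqNgt ltn_neqAle andbC.
Qed.

Lemma lie_poisson_double :
  (lie_poisson e lin : mv) *+ 2 =
  \sum_(i < n) \sum_(j < n) fn (lin (mxcomm e`_i e`_j)) * (xi K i * xi K j).
Proof.
apply: (@sum_lt_sym mv (fun i j => fn (lin (mxcomm e`_i e`_j)) * (xi K i * xi K j)))
  => [i j|i]; last by rewrite /mxcomm subrr linear0 raddf0 mul0r.
by rewrite mxcommN (xiN i) !raddfN /= mulNr mulrN opprK.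
Qed.

(** Jacobi identity for the commutator.  In the square of the bivector the coefficient of
    xi_k xi_i xi_j is lin [[e_i, e_j], e_k], up to a factor; cyclic permutations of the three odd
    variables do not change their product, so the coefficient may be replaced by its cyclic sum. *)
Lemma lie_poisson_poisson : bracket (lie_poisson e lin : mv) (lie_poisson e lin) = 0.
Proof.
set P : mv := lie_poisson e lin.
have dP : deg 2 P by exact: deg_lie_poisson.
rewrite (bracket_deg2 _ dP); apply/eqP; rewrite oppr_eq0; apply/eqP.
have dP2 : deg 2 (P *+ 2) by rewrite mulr2n; apply: degD.
apply: (@mv_natmul_eq0 K n charK 3).
(* Doubling P makes the sum over ordered pairs available, see sum_lt_sym. *)
transitivity (neg_ad (P *+ 2) (P *+ 2)); 
  first by rewrite mulr2n neg_adDl !neg_adDr !mulrS mulr0n addr0 !addrA.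
rewrite (neg_ad_self dP2).
pose L i j := lin (mxcomm e`_i e`_j).
have exi l : dxi l (P *+ 2) = (\sum_(k < n) fn (L l k) * xi K k) *+ 2.
  rewrite lie_poisson_double raddf_sum /=.
  transitivity (\sum_(i < n) \sum_(j < n)
      (fn (L i j) * ((l == i)%:R * xi K j) - fn (L i j) * (xi K i * (l == j)%:R))).
    apply: eq_bigr => i _; rewrite raddf_sum /=; apply: eq_bigr => j _.
    by rewrite dxi_fnM dxiM !dxi_xi (rho_deg (deg_xi K i)) mulNr mulrBr.
  transitivity (\sum_(i < n) \sum_(j < n) fn (L i j) * ((l == i)%:R * xi K j) -
      \sum_(i < n) \sum_(j < n) fn (L i j) * (xi K i * (l == j)%:R)).
    by rewrite -sumrB; apply: eq_bigr => i _; rewrite -sumrB.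
  rewrite [X in _ - X]exchange_big /= mulr2n; congr (_ + _).
    rewrite (bigD1 l) //= [X in _ + X]big1 ?addr0 => [|i /negPf nil].
      by apply: eq_bigr => j _; rewrite eqxx mul1r.
    by rewrite big1 // => j _; rewrite eq_sym nil mul0r mulr0.
  rewrite (bigD1 l) //= [X in _ + X]big1 ?addr0 => [|j /negPf njl]; last first.
    by rewrite big1 // => i _; rewrite eq_sym njl !mulr0.
  rewrite -sumrN; apply: eq_bigr => i _; rewrite eqxx mulr1 -mulNr -raddfN /=.
  by rewrite /L (mxcommN e`_i) linearN opprK.
have ex l : dx l (P *+ 2) = \sum_(i < n) \sum_(j < n) fn (L i j)^`M(l) * (xi K i * xi K j).
  rewrite lie_poisson_double raddf_sum /=; apply: eq_bigr => i _.
  rewrite raddf_sum /=; apply: eq_bigr => j _.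
  by rewrite dxM dx_fn dxM !dx_xi mul0r mulr0 addr0 mulr0 addr0.
have contract (i j k : 'I_n) : \sum_(l < n) L l k * (L i j)^`M(l) =
    lin (mxcomm (mxcomm e`_i e`_j) e`_k).
  have [c ec Lc] := e_span i j.
  rewrite ec {1}/mxcomm mulmx_suml mulmx_sumr -sumrB raddf_sum /=.
  apply: eq_bigr => l _; rewrite -scalemxAl -scalemxAr -scalerBr linearZ /=.
  rewrite /L Lc raddf_sum /= (bigD1 l) //= big1 ?addr0 => [|m /negPf nml].
    by rewrite mderivZ mderivXU eqxx -scalerAr mulr1.
  by rewrite mderivZ mderivXU nml scaler0.
pose J (i j k : 'I_n) := lin (mxcomm (mxcomm e`_i e`_j) e`_k).
pose Z (F : 'I_n -> 'I_n -> 'I_n -> {mpoly K[n]}) : mv :=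
  \sum_k \sum_i \sum_j fn (F i j k) * (xi K k * xi K i * xi K j).
have ZD F G : Z F + Z G = Z (fun i j k => F i j k + G i j k).
  rewrite -big_split; apply: eq_bigr => k _; rewrite -big_split; apply: eq_bigr => i _.
  by rewrite -big_split; apply: eq_bigr => j _; rewrite /= raddfD mulrDl.
have Zrot F : Z F = Z (fun i j k => F j k i).
  rewrite /Z sum3_rot; apply: eq_bigr => k _; apply: eq_bigr => i _.
  apply: eq_bigr => j _ /=; congr (_ * _).
  by rewrite (deg2C (xi K k) (degM (deg_xi K i) (deg_xi K j))) mulrA.
have Z0 : Z J = 0.
  apply: (@mv_natmul_eq0 K n charK 2).
  transitivity (Z (fun i j k => J i j k + J j k i + J k i j)).
    rewrite -(ZD (fun i j k => J i j k + J j k i) (fun i j k => J k i j)).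
    rewrite -(ZD J (fun i j k => J j k i)) -(Zrot (fun i j k => J j k i)) -(Zrot J).
    by rewrite !mulrS mulr0n addr0 addrA.
  rewrite /Z big1 // => k _; rewrite big1 // => i _; rewrite big1 // => j _.
  by rewrite /J -!linearD mxcomm_jacobi linear0 raddf0 mul0r.
suff -> : \sum_(l < n) dxi l (P *+ 2) * dx l (P *+ 2) = Z J *+ 2 by rewrite Z0 !mul0rn.
transitivity (\sum_(l < n) (\sum_(k < n) fn (L l k) * xi K k *
    (\sum_(i < n) \sum_(j < n) fn (L i j)^`M(l) * (xi K i * xi K j))) *+ 2).
  by apply: eq_bigr => l _; rewrite exi ex mulrnAl mulr_suml.
rewrite sumrMnl; congr (_ *+ 2).
rewrite exchange_big; apply: eq_bigr => k _ /=.
under eq_bigr do rewrite mulr_sumr.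
rewrite exchange_big; apply: eq_bigr => i _ /=.
under eq_bigr do rewrite mulr_sumr.
rewrite exchange_big; apply: eq_bigr => j _ /=.
rewrite /J -contract raddf_sum mulr_suml; apply: eq_bigr => l _ /=.
by rewrite fnM -!mulrA; congr (_ * _); rewrite !mulrA Mfn.
Qed.
End LiePoisson.

(** * Matrix coordinates of the Lie algebra sl(3) *)

Section SL3.
Variable K : fieldType.
Hypothesis charK : [pchar K] =i pred0.
Notation mv := (multivector K 8).
Notation e := (sl3_basis K).
Implicit Types (A B M : 'M[K]_3).

Lemma sum_ord3 (V : nmodType) (F : 'I_3 -> V) :
  \sum_i F i = F (inord 0) + F (inord 1) + F (inord 2).
Proof.
rewrite !big_ord_recl big_ord0 addr0 addrA.
by congr (F _ + F _ + F _); apply: val_inj; rewrite /= inordK.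
Qed.

Lemma sum_ord8 (V : nmodType) (F : 'I_8 -> V) :
  \sum_i F i = F (inord 0) + F (inord 1) + F (inord 2) + F (inord 3)
             + F (inord 4) + F (inord 5) + F (inord 6) + F (inord 7).
Proof.
rewrite !big_ord_recl big_ord0 addr0 !addrA.
by congr (F _ + F _ + F _ + F _ + F _ + F _ + F _ + F _); apply: val_inj; rewrite /= inordK.
Qed.

Lemma entryM A B a b : entry (A *m B) a b =
  entry A a 1 * entry B 1 b + entry A a 2 * entry B 2 b + entry A a 3 * entry B 3 b.
Proof. by rewrite /entry mxE sum_ord3. Qed.
Lemma entryB A B a b : entry (A - B) a b = entry A a b - entry B a b.
Proof. by rewrite /entry !mxE. Qed.
Lemma entryD A B a b : entry (A + B) a b = entry A a b + entry B a b.
Proof. by rewrite /entry !mxE. Qed.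
Lemma entryZ c A a b : entry (c *: A) a b = c * entry A a b.
Proof. by rewrite /entry !mxE. Qed.

Lemma entry_Emx i j a b :
  [&& (0 < i <= 3)%N, (0 < j <= 3)%N, (0 < a <= 3)%N & (0 < b <= 3)%N] ->
  entry (Emx K i j) a b = ((a == i) && (b == j))%:R.
Proof.
case/and4P => hi hj ha hb; rewrite /entry /Emx mxE -!val_eqE /= !inordK; try lia.
by case: i j a b hi hj ha hb => [|i] [|j] [|a] [|b].
Qed.

(** Matrix identities are checked on entries with indices 1, 2, 3, which compute, unlike the
    indices obtained by [inord]. *)
Lemma entry_eq A B :
  (forall a b, (0 < a <= 3)%N -> (0 < b <= 3)%N -> entry A a b = entry B a b) -> A = B.
Proof.
move=> AB; apply/matrixP => i j; have := AB i.+1 j.+1.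
by rewrite /entry /= !inord_val; apply; rewrite ltn_ord.
Qed.

Lemma trace_entry A : \tr A = entry A 1 1 + entry A 2 2 + entry A 3 3.
Proof. exact: sum_ord3. Qed.

Fact sl3_lin_linear : linear (@sl3_lin K).
Proof.
move=> c A B; rewrite /sl3_lin scaler_sumr -big_split; apply: eq_bigr => k _ /=.
rewrite scalerA -scalerDl; congr (_ *: _); rewrite /sl3_coord !entryD !entryZ.
by case: k => [[|[|[|[|[|[|[|[|k]]]]]]]] hk].
Qed.
HB.instance Definition _ :=
  GRing.isLinear.Build K 'M[K]_3 {mpoly K[8]} _ (@sl3_lin K) sl3_lin_linear.

(** Coordinates are read on six off-diagonal entries and two diagonal ones; the last diagonal entry
    is the opposite of the sum of the first two. *)
Lemma sl3_span M : \tr M = 0 -> M = \sum_(k < 8) (sl3_coord M)`_k *: e`_k.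
Proof.
rewrite trace_entry => trM.
have M33 : entry M 3 3 = - entry M 1 1 - entry M 2 2.
  by apply/eqP; rewrite -subr_eq0 -trM; apply/eqP; ring.
apply: entry_eq => a b ha hb; rewrite sum_ord8 !entryD !entryZ !inordK //= !entryB.
by case: a b ha hb => [|[|[|[|a]]]] [|[|[|[|b]]]] // _ _;
  rewrite !entry_Emx //= ?M33; ring.
Qed.

Lemma mxcomm_trace A B : \tr (mxcomm A B) = 0.
Proof. by rewrite raddfB /= mxtrace_mulC subrr. Qed.

Lemma sl3_basis_span (i j : 'I_8) : exists2 c : 'I_8 -> K,
  mxcomm e`_i e`_j = \sum_k c k *: e`_k &
  sl3_lin (mxcomm e`_i e`_j) = \sum_k c k *: 'X_k.
Proof.
by exists (fun k => (sl3_coord (mxcomm e`_i e`_j))`_k); rewrite // -sl3_span ?mxcomm_trace.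
Qed.

Lemma sl3_poisson : bracket (P K : mv) (P K) = 0.
Proof. exact: (lie_poisson_poisson charK sl3_basis_span). Qed.

Lemma deg_P : deg 2 (P K : mv).
Proof. exact: (deg_lie_poisson e (@sl3_lin K)). Qed.
End SL3.

(** * The Lie-Poisson bivector of sl(3) has generic rank 6 *)

Section Evaluation.
Variables (K : fieldType) (n : nat) (h : 'I_n -> K).
Notation mv := (multivector K n).
(** Evaluation of the coefficients at a point h, a ring morphism to the fields with constant
    coefficients. *)
Definition evalmv (R : mv) : mv := [ffun I => ((R I).@[h])%:MP].
Lemma evalmvE (R : mv) I : evalmv R I = ((R I).@[h])%:MP. Proof. by rewrite ffunE. Qed.
Fact evalmv_additive : zmod_morphism evalmv.
Proof. by move=> R Q; apply/ffunP => I; rewrite !ffunE mevalB mpolyCB. Qed.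
HB.instance Definition _ := GRing.isZmodMorphism.Build mv mv evalmv evalmv_additive.

Lemma evalmvM R Q : evalmv (R * Q) = evalmv R * evalmv Q.
Proof.
apply/ffunP => I; rewrite evalmvE !mv_mulE (rmorph_sum (meval h)) (rmorph_sum (@mpolyC n K)) /=.
apply: eq_bigr => A _.
rewrite !evalmvE !rmorphM /= -signr_odd.
by case: odd; rewrite ?expr0 ?expr1 ?rmorph1 // ?rmorphN1.
Qed.

Lemma evalmv_fn f : evalmv (fn f) = fn (f.@[h])%:MP.
Proof. by apply/ffunP => I; rewrite evalmvE !ffunE; case: ifP; rewrite ?rmorph0. Qed.

Lemma evalmv_xi i : evalmv (xi K i) = xi K i.
Proof. by apply/ffunP => I; rewrite evalmvE !ffunE; case: eqP; rewrite ?rmorph0 ?rmorph1. Qed.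
End Evaluation.

Section Rank.
Variable K : fieldType.
Hypothesis charK : [pchar K] =i pred0.
Notation mv := (multivector K 8).
Notation e := (sl3_basis K).

(** Under the trace form, a diagonal matrix with eigenvalue differences y13 = 2 and y23 = 1, hence
    regular. *)
Definition cartan_point : 'I_8 -> K := fun k => nth 0 [:: 0; 0; 0; 0; 0; 0; 2; 1] k.
Notation h := cartan_point.

Lemma sl3_lin_cartan M : (sl3_lin M).@[h] = entry M 1 1 *+ 2 + entry M 2 2.
Proof.
rewrite /sl3_lin (rmorph_sum (meval h)) sum_ord8 /= !mevalZ !mevalXU /cartan_point !inordK //=.
by ring.
Qed.

(** At [cartan_point] the only nonzero brackets are {x12, x21} = y13 - y23 = 1,
    {x13, x31} = y13 = 2 and {x23, x32} = y23 = 1. *)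
Definition cartan_coef (i j : nat) : nat :=
  match i, j with 0, 2 => 1 | 1, 4 => 2 | 3, 5 => 1 | _, _ => 0 end%N.

Lemma bracket_cartan i j : (i < j < 8)%N ->
  entry (mxcomm e`_i e`_j) 1 1 *+ 2 + entry (mxcomm e`_i e`_j) 2 2 = (cartan_coef i j)%:R.
Proof.
have nthE : (e`_0 = Emx K 1 2) * (e`_1 = Emx K 1 3) * (e`_2 = Emx K 2 1) * (e`_3 = Emx K 2 3) *
  (e`_4 = Emx K 3 1) * (e`_5 = Emx K 3 2) * (e`_6 = Emx K 1 1 - Emx K 3 3) *
  (e`_7 = Emx K 2 2 - Emx K 3 3) by [].
rewrite !entryB !entryM.
case: i => [|[|[|[|[|[|[|i]]]]]]]; [..|by move=> /andP[]; lia];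
  (case: j => [|[|[|[|[|[|[|[|j]]]]]]]]; try by move=> /andP[]; lia);
  move=> _; rewrite !nthE ?entryB !entry_Emx // /=; ring.
Qed.

Lemma sum_cartan (V : nmodType) (g : nat -> nat -> V) :
  \sum_(i < 8) \sum_(j < 8) g i j *+ (if (i < j)%N then cartan_coef i j else 0%N) =
  g 0%N 2%N + g 1%N 4%N *+ 2 + g 3%N 5%N.
Proof.
by rewrite !big_ord_recl !big_ord0 /= !mulr0n !addr0 !add0r mulr1n addrA.
Qed.

Lemma P_cartan : evalmv h (P K : mv) =
  xi K (inord 0) * xi K (inord 2) + (xi K (inord 1) * xi K (inord 4)) *+ 2 +
  xi K (inord 3) * xi K (inord 5).
Proof.
transitivity (\sum_(i < 8) \sum_(j < 8)
    (xi K i * xi K j) *+ (if (i < j)%N then cartan_coef i j else 0%N)).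
  rewrite [P K]lie_poissonE raddf_sum; apply: eq_bigr => i _.
  rewrite raddf_sum big_mkcond; apply: eq_bigr => j _ /=; case: ifP => // ij.
  rewrite evalmvM evalmv_fn evalmvM !evalmv_xi sl3_lin_cartan bracket_cartan ?ij ?ltn_ord //.
  set m := cartan_coef i j; have -> : fn m%:R%:MP = m%:R :> mv.
    by rewrite mpolyC_nat; exact: raddfMn.
  by rewrite mulr_natl.
rewrite -(sum_cartan (fun i j => xi K (inord i) * xi K (inord j))).
by apply: eq_bigr => i _; apply: eq_bigr => j _; rewrite !inord_val.
Qed.

Lemma xi_mul_neq0 n i (R : multivector K n) : dxi i R = 0 -> R != 0 -> xi K i * R != 0.
Proof.
move=> iR; apply: contra => /eqP xR0; apply/eqP.
by have := congr1 (dxi i) xR0; rewrite dxiM dxi_xi eqxx mul1r iR mulr0 addr0 raddf0.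
Qed.

(** The multinomial expansion for three commuting elements of square zero. *)
Lemma cube_sum3 n (R S T : multivector K n) : deg 2 R -> deg 2 S -> deg 2 T ->
  R * R = 0 -> S * S = 0 -> T * T = 0 ->
  (R + S + T) * (R + S + T) * (R + S + T) = (R * S * T) *+ 6.
Proof.
move=> dR dS dT R2 S2 T2.
have CR := deg2C _ dR; have CS := deg2C _ dS.
have -> : (R + S + T) * (R + S + T) = (R * S + R * T + S * T) *+ 2.
  rewrite !mulrDl !mulrDr R2 S2 T2 -(CR S) -(CR T) -(CS T) !addr0 add0r.
  by rewrite mulr2n !addrA [LHS](ACl (1*2*4*3*5*6)).
rewrite mulrnAl (mulrnA _ 3 2); congr (_ *+ 2).
(* Each of the three factors completes exactly one of the products to R S T. *)
have XR : (R * S + R * T + S * T) * R = R * S * T.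
  by rewrite -CR !mulrDr !mulrA R2 !mul0r !add0r.
have XS : (R * S + R * T + S * T) * S = R * S * T.
  by rewrite -CS !mulrDr !mulrA -(CR S) S2 mul0r addr0 -mulrA S2 mulr0 add0r.
have XT : (R * S + R * T + S * T) * T = R * S * T.
  by rewrite !mulrDl -!mulrA T2 !mulr0 !addr0.
by rewrite mulrDr mulrDr XR XS XT mulrS mulr2n addrA.
Qed.

Lemma xiM_sq n i j : xi K i * xi K j * (xi K i * xi K j) = 0 :> multivector K n.
Proof.
rewrite mulrA -[_ * _ * xi K i]mulrA (xiN K j i) mulrN mulNr mulrA.
by rewrite (deg1_sq charK (deg_xi K i)) !mul0r oppr0.
Qed.

(** At [cartan_point] the cube is 12 times the product of six distinct odd variables. *)
Lemma P_cube_neq0 : (P K : mv) * P K * P K != 0.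
Proof.
suff : evalmv h ((P K : mv) * P K * P K) != 0 by apply: contra => /eqP ->; rewrite raddf0.
rewrite !evalmvM P_cartan.
have deg_xx i j : deg 2 (xi K i * xi K j : mv) := degM (deg_xi K i) (deg_xi K j).
rewrite cube_sum3 //; last first.
- exact: xiM_sq.
- by rewrite mulrnAl mulrnAr xiM_sq !mul0rn.
- exact: xiM_sq.
- by rewrite mulr2n; apply: degD.
rewrite mulrnAr mulrnAl -mulrnA.
apply/eqP => /(mv_natmul_eq0 charK)/eqP; apply/negP.
rewrite -!mulrA.
have inordE a b : (a < 8)%N -> (b < 8)%N -> (inord a == inord b :> 'I_8) = (a == b).
  by move=> ha hb; rewrite -val_eqE /= !inordK.
(* Strip the odd variables one by one: each derivative kills the remaining product. *)
do 5 (apply: xi_mul_neq0; first by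
  rewrite !(dxiM, dxi_xi) !inordE //= ?(mul0r, mulr0, addr0, raddf0)).
apply/eqP => /(congr1 (fun R : mv => R [set inord 5])); rewrite ffunE eqxx mv_0E.
by move/eqP; rewrite oner_eq0.
Qed.
End Rank.

(** * Adding the central coordinate *)

(** Polynomials are generated by constants and variables; used to check the chain rule for
    [lift_poly]. *)
Lemma mpoly_alg_ind (K : fieldType) n (T : {mpoly K[n]} -> Prop) :
  (forall c, T c%:MP) -> (forall i, T 'X_i) ->
  (forall f g, T f -> T g -> T (f + g)) -> (forall f g, T f -> T g -> T (f * g)) ->
  forall f, T f.
Proof.
move=> TC TX TD TM; elim/mpolyind => [|c m p _ _ Tp]; first by rewrite -mpolyC0.
apply: (TD) => //; rewrite -mul_mpolyC; apply: (TM) => //.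
rewrite mpolyXE_id; elim/big_ind: _ => // [|i _]; first exact: TC 1.
by elim: (m i) => [|k IH]; rewrite ?expr0 ?exprS; [exact: TC 1|apply: TM].
Qed.

Section Lift.
Variable K : fieldType.
Notation mv8 := (multivector K 8).
Notation mv9 := (multivector K 9).
Notation up := (lift (@ord0 8)).
Implicit Types (R Q : mv8) (f g : {mpoly K[8]}).

Lemma lift_polyD f g : lift_poly (f + g) = lift_poly f + lift_poly g.
Proof. exact: rmorphD. Qed.
Lemma lift_polyM f g : lift_poly (f * g) = lift_poly f * lift_poly g.
Proof. exact: rmorphM. Qed.
Lemma lift_poly_sum (T : finType) (p : pred T) (F : T -> {mpoly K[8]}) :
  lift_poly (\sum_(t | p t) F t) = \sum_(t | p t) lift_poly (F t).
Proof. exact: rmorph_sum. Qed.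
Lemma lift_polyC c : lift_poly (c%:MP : {mpoly K[8]}) = c%:MP.
Proof. exact: comp_mpolyC. Qed.
Lemma lift_polyX k : lift_poly ('X_k : {mpoly K[8]}) = 'X_(up k).
Proof. by rewrite /lift_poly comp_mpolyXU -tnth_nth tnth_mktuple. Qed.

Lemma lift_poly_deriv k f : (lift_poly f)^`M(up k) = lift_poly f^`M(k).
Proof.
elim/mpoly_alg_ind: f => [c|i|f g Df Dg|f g Df Dg].
- by rewrite lift_polyC !mderivC -mpolyC0 lift_polyC.
- rewrite lift_polyX !mderivXU (inj_eq lift_inj) -!mpolyC_nat; exact/esym/lift_polyC.
- by rewrite mderivD lift_polyD mderivD Df Dg lift_polyD.
- by rewrite mderivM lift_polyM mderivM Df Dg lift_polyD !lift_polyM.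
Qed.

Lemma lift_poly_deriv0 f : (lift_poly f)^`M(ord0) = 0.
Proof.
elim/mpoly_alg_ind: f => [c|i|f g Df Dg|f g Df Dg].
- by rewrite lift_polyC mderivC.
- by rewrite lift_polyX mderivXU.
- by rewrite lift_polyD mderivD Df Dg addr0.
- by rewrite lift_polyM mderivM Df Dg mul0r mulr0 addr0.
Qed.

(** Extension of fields from sl(3) dual to gl(3) dual, an injection of superalgebras which commutes
    with the derivatives in the old variables and whose image is killed by those in the new ones;
    hence it preserves brackets ([bracket_liftmv]). *)
Definition liftmv R : mv9 := lift_field R.

Lemma liftmv_ord0 R (I : {set 'I_9}) : ord0 \in I -> liftmv R I = 0.
Proof. by rewrite ffunE => ->. Qed.

Lemma up_ord0 (J : {set 'I_8}) : (ord0 \in up @: J) = false.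
Proof. by apply/imsetP => -[k _] /eqP; rewrite (negPf (neq_lift _ _)). Qed.

Lemma mem_up k (J : {set 'I_8}) : (up k \in up @: J) = (k \in J).
Proof. exact: mem_imset lift_inj. Qed.

Lemma liftmvE R (J : {set 'I_8}) : liftmv R (up @: J) = lift_poly (R J).
Proof.
rewrite ffunE up_ord0; congr (lift_poly (R _)).
by apply/setP => k; rewrite inE mem_up.
Qed.

Lemma upP (I : {set 'I_9}) : (ord0 \in I) + {J : {set 'I_8} | I = up @: J}.
Proof.
case: (boolP (ord0 \in I)) => [I0|I0]; first by left.
right; exists [set k | up k \in I]; apply/setP => i.
case: (unliftP ord0 i) => [k ->|->]; first by rewrite mem_up inE.
by rewrite up_ord0 (negPf I0).
Qed.

Lemma liftmv_ext (R : mv8) (Q : mv9) :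
  (forall I : {set 'I_9}, ord0 \in I -> Q I = 0) ->
  (forall J : {set 'I_8}, Q (up @: J) = lift_poly (R J)) ->
  Q = liftmv R.
Proof.
move=> Q0 QJ; apply/ffunP => I; case: (upP I) => [I0|[J ->]].
  by rewrite Q0 ?liftmv_ord0.
by rewrite QJ liftmvE.
Qed.

Fact liftmv_additive : zmod_morphism liftmv.
Proof.
move=> R Q; apply/esym/liftmv_ext => [I I0|J]; rewrite mv_addE mv_oppE.
  by rewrite !liftmv_ord0 ?subr0.
by rewrite !liftmvE mv_addE mv_oppE /lift_poly rmorphB.
Qed.
HB.instance Definition _ := GRing.isZmodMorphism.Build mv8 mv9 liftmv liftmv_additive.

Lemma inversions_up (A B : {set 'I_8}) : inversions (up @: A) (up @: B) = inversions A B.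
Proof.
rewrite !inversionsE big_imset /=; last by move=> ? ? _ _; apply: lift_inj.
by apply: eq_bigr => a _; rewrite big_imset //= => ? ? _ _; apply: lift_inj.
Qed.

Lemma imset_upD (A B : {set 'I_8}) : up @: A :\: up @: B = up @: (A :\: B).
Proof.
apply/setP => i; case: (unliftP ord0 i) => [k ->|->]; first by rewrite !(mem_up, inE).
by rewrite inE !up_ord0.
Qed.

Lemma lift_poly_sign k : lift_poly ((-1) ^+ k : {mpoly K[8]}) = (-1) ^+ k.
Proof. by rewrite /lift_poly rmorphXn rmorphN1. Qed.

Lemma liftmvM R Q : liftmv (R * Q) = liftmv R * liftmv Q.
Proof.
apply/esym/liftmv_ext => [I I0|J]; rewrite mv_mulE.
  rewrite big1 // => A sAI; case: (boolP (ord0 \in A)) => A0.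
    by rewrite liftmv_ord0 // mul0r mulr0.
  by rewrite [liftmv Q _]liftmv_ord0 ?mulr0 // inE A0.
rewrite mv_mulE lift_poly_sum.
rewrite (reindex_onto (fun B : {set 'I_8} => up @: B) 
  (fun A : {set 'I_9} => [set k | up k \in A])) /=.
  apply: eq_big => [B|B _].
    have -> : [set k | up k \in up @: B] = B by apply/setP => k; rewrite inE mem_up.
    rewrite eqxx andbT; apply/subsetP/subsetP => sB k.
      by move=> kB; rewrite -mem_up sB ?mem_up.
    by case/imsetP => l lB ->; rewrite mem_up sB.
  by rewrite imset_upD inversions_up !liftmvE -lift_poly_sign -!lift_polyM.
move=> A sA; apply/setP => i; case: (unliftP ord0 i) => [k ->|->].
  by rewrite mem_up inE.
by rewrite up_ord0; apply/esym/negbTE/negP => /(subsetP sA); rewrite up_ord0.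
Qed.

Lemma liftmv_fn f : liftmv (fn f) = fn (lift_poly f).
Proof.
apply/esym/liftmv_ext => [I I0|J]; rewrite !ffunE.
  by case: eqP => // e; rewrite e inE in I0.
by rewrite imset_eq0; case: eqP => //; rewrite /lift_poly raddf0.
Qed.

Lemma liftmv_xi k : liftmv (xi K k) = xi K (up k).
Proof.
apply/esym/liftmv_ext => [I I0|J]; rewrite !ffunE.
  by case: eqP => // e; rewrite e inE (negPf (neq_lift _ _)) in I0.
rewrite -imset_set1 (inj_eq (imset_inj lift_inj)) /lift_poly; exact/esym/rmorph_nat.
Qed.

Lemma rho_liftmv R : rho (liftmv R) = liftmv (rho R).
Proof.
apply: liftmv_ext => [I I0|J]; rewrite rhoE; first by rewrite liftmv_ord0 ?mulr0.
by rewrite liftmvE rhoE lift_polyM lift_poly_sign card_imset //; apply: lift_inj.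
Qed.

Lemma dx_liftmv k R : dx (up k) (liftmv R) = liftmv (dx k R).
Proof.
apply: liftmv_ext => [I I0|J]; rewrite dxE; first by rewrite liftmv_ord0 // mderiv0.
by rewrite liftmvE lift_poly_deriv dxE.
Qed.

Lemma dx0_liftmv R : dx ord0 (liftmv R) = 0.
Proof.
apply/ffunP => I; rewrite dxE mv_0E; case: (upP I) => [I0|[J ->]].
  by rewrite liftmv_ord0 // mderiv0.
by rewrite liftmvE lift_poly_deriv0.
Qed.

Lemma dxi_liftmv k R : dxi (up k) (liftmv R) = liftmv (dxi k R).
Proof.
apply: liftmv_ext => [I I0|J]; rewrite dxiE.
  by case: ifP => // _; rewrite liftmv_ord0 ?mulr0 // inE I0 orbT.
rewrite mem_up dxiE; case: ifP => _; first by rewrite /lift_poly raddf0.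
by rewrite -imset_set1 inversions_up -imsetU liftmvE lift_polyM lift_poly_sign.
Qed.

Lemma dxi0_liftmv R : dxi ord0 (liftmv R) = 0.
Proof.
apply/ffunP => I; rewrite dxiE mv_0E; case: ifP => // _.
by rewrite liftmv_ord0 ?mulr0 // setU11.
Qed.

Lemma bracket_liftmv R Q : bracket (liftmv R) (liftmv Q) = liftmv (bracket R Q).
Proof.
rewrite !bracketE big_ord_recl !dxi0_liftmv !dx0_liftmv !mulr0 subrr add0r raddf_sum.
by apply: eq_bigr => k _; rewrite !(dxi_liftmv, dx_liftmv, rho_liftmv) raddfB /= !liftmvM.
Qed.

Lemma deg_liftmv d R : deg d R -> deg d (liftmv R).
Proof.
move=> dR; apply/degP => I; case: (upP I) => [I0|[J ->]]; first by rewrite liftmv_ord0 ?eqxx.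
rewrite liftmvE card_imset; last exact: lift_inj.
by apply: contraNeq => nJ; rewrite (deg_eq0 dR) // /lift_poly raddf0.
Qed.
End Lift.

(** * Homogeneous coefficients *)

Section HomogPoly.
Variable K : fieldType.

Lemma mdeg_msupp n d (f : {mpoly K[n]}) m : f \is d.-homog -> m \in msupp f -> mdeg m = d.
Proof. by move=> fd; apply: (dhomogP _ _ _ fd). Qed.

Lemma mderiv_dhomog n d i (f : {mpoly K[n]}) : f \is d.+1.-homog -> f^`M(i) \is d.-homog.
Proof.
move=> fd; apply/dhomogP => m; rewrite mcoeff_msupp mcoeff_deriv => nz.
have : (m + U_(i))%MM \in msupp f.
  by rewrite mcoeff_msupp; apply: contraNneq nz => ->; rewrite mul0rn.
by move/(mdeg_msupp fd); rewrite mdegD mdeg1 addn1 => -[].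
Qed.

Lemma prod_dhomog n m (d : 'I_m -> nat) (g : 'I_m -> {mpoly K[n]}) :
  (forall i, g i \is (d i).-homog) -> \prod_i g i \is (\sum_i d i)%N.-homog.
Proof.
by move=> gd; elim/big_rec2: _ => [|i y z _ yz]; [exact: dhomog1|apply: dhomogM].
Qed.

Lemma lift_poly_dhomog d (f : {mpoly K[8]}) : f \is d.-homog -> lift_poly f \is d.-homog.
Proof.
move=> fd; rewrite /lift_poly comp_mpolyE big_seq; apply: rpred_sum => m mf.
apply: dhomogZ; rewrite -(mdeg_msupp fd mf) mdegE; apply: prod_dhomog => i.
rewrite tnth_mktuple; have := @dhomogMn _ _ _ 1 'X_(lift ord0 i) (m i).
by rewrite mul1n; apply; rewrite dhomogX; apply/eqP/mdeg1.
Qed.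

(** Euler's identity in degree one. *)
Lemma euler_linear n (f : {mpoly K[n]}) : f \is 1.-homog -> \sum_i 'X_i * f^`M(i) = f.
Proof.
move=> f1; rewrite [in RHS](mpolyE f) [in LHS](mpolyE f).
under eq_bigr do rewrite raddf_sum mulr_sumr.
rewrite exchange_big /= big_seq [RHS]big_seq; apply: eq_bigr => m mf.
have /mdeg1P[j /eqP ->] : mdeg m == 1%N by rewrite (mdeg_msupp f1 mf).
rewrite (bigD1 j) //= big1 ?addr0 => [|i /negPf ij].
  by rewrite mderivZ mderivXU eqxx -scalerAr mulr1.
by rewrite mderivZ mderivXU eq_sym ij scaler0 mulr0.
Qed.

(** All coordinates of sl(3) dual vanish on the central line. *)
Lemma lift_poly_central (a : 'I_9 -> K) d (f : {mpoly K[8]}) :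
  (forall k, a (lift ord0 k) = 0) -> f \is d.+1.-homog -> (lift_poly f).@[a] = 0.
Proof.
move=> a0 fd; rewrite comp_mpoly_meval mevalE big_seq big1 // => m mf.
suff [i mi] : exists i, m i != 0%N.
  by rewrite (bigD1 i) //= tnth_mktuple mevalXU a0 expr0n (negPf mi) mul0r mulr0.
apply/existsP; apply: contraT; rewrite negb_exists => /forallP m0.
have := mdeg_msupp fd mf; rewrite mdegE big1 // => i _.
by apply/eqP; rewrite -[_ == _]negbK.
Qed.

Section Chom.
Variable n : nat.
Notation mv := (multivector K n).
Implicit Types (R Q : mv).

(** Homogeneity of the coefficients in the even variables, as opposed to [deg]. *)
Definition coef_homog d R := [forall I, R I \is d.-homog].

Lemma coef_homogP d R : reflect (forall I, R I \is d.-homog) (coef_homog d R).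
Proof. exact: forallP. Qed.

Lemma coef_homog0 d : coef_homog d 0.
Proof. by apply/coef_homogP => I; rewrite mv_0E rpred0. Qed.
Lemma coef_homogD d R Q : coef_homog d R -> coef_homog d Q -> coef_homog d (R + Q).
Proof.
by move=> /coef_homogP rd /coef_homogP qd; apply/coef_homogP => I; rewrite mv_addE rpredD.
Qed.
Lemma coef_homogN d R : coef_homog d R -> coef_homog d (- R).
Proof. by move=> /coef_homogP rd; apply/coef_homogP => I; rewrite mv_oppE rpredN. Qed.
Lemma coef_homogB d R Q : coef_homog d R -> coef_homog d Q -> coef_homog d (R - Q).
Proof. by move=> rd qd; apply: coef_homogD => //; apply: coef_homogN. Qed.
Lemma coef_homogZ d (a : K) R : coef_homog d R -> coef_homog d (a *: R).
Proof. by move=> /coef_homogP rd; apply/coef_homogP => I; rewrite ffunE dhomogZ. Qed.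
Lemma coef_homog_sum d (V : Type) (r : seq V) (p : pred V) (F : V -> mv) :
  (forall v, p v -> coef_homog d (F v)) -> coef_homog d (\sum_(v <- r | p v) F v).
Proof.
move=> dF; apply: (big_ind (fun R => coef_homog d R)) => //.
  exact: coef_homog0.
exact: coef_homogD.
Qed.

Lemma sign_dhomog k d (f : {mpoly K[n]}) : f \is d.-homog -> (-1) ^+ k * f \is d.-homog.
Proof.
by move=> fd; rewrite -signr_odd; case: odd; rewrite ?expr0 ?expr1 ?mul1r ?mulN1r ?rpredN.
Qed.

Lemma coef_homogM a b R Q : coef_homog a R -> coef_homog b Q -> coef_homog (a + b) (R * Q).
Proof.
move=> /coef_homogP rd /coef_homogP qd; apply/coef_homogP => I.
rewrite mv_mulE; apply: rpred_sum => A _.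
by apply: sign_dhomog; apply: dhomogM.
Qed.
Lemma coef_homog_rho d R : coef_homog d R -> coef_homog d (rho R).
Proof. by move=> /coef_homogP rd; apply/coef_homogP => I; rewrite rhoE sign_dhomog. Qed.
Lemma coef_homog_dxi i d R : coef_homog d R -> coef_homog d (dxi i R).
Proof.
move=> /coef_homogP rd; apply/coef_homogP => I.
by rewrite dxiE; case: ifP; rewrite ?rpred0 ?sign_dhomog.
Qed.
Lemma coef_homog_dx i d R : coef_homog d.+1 R -> coef_homog d (dx i R).
Proof. by move=> /coef_homogP rd; apply/coef_homogP => I; rewrite dxE mderiv_dhomog. Qed.
Lemma coef_homog_fn d f : f \is d.-homog -> coef_homog d (fn f : mv).
Proof. by move=> fd; apply/coef_homogP => I; rewrite ffunE; case: ifP; rewrite ?rpred0. Qed.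
Lemma coef_homog_xi i : coef_homog 0 (xi K i : mv).
Proof. by apply/coef_homogP => I; rewrite ffunE; case: eqP; rewrite ?rpred0 ?dhomog1. Qed.

Lemma coef_homog_bracket a b R Q :
  coef_homog a.+1 R -> coef_homog b.+1 Q -> coef_homog (a + b).+1 (bracket R Q).
Proof.
move=> rd qd; rewrite bracketE; apply: coef_homog_sum => i _; apply: coef_homogB.
  by apply: (@coef_homogM a.+1 b); [apply/coef_homog_rho/coef_homog_dxi|apply: coef_homog_dx].
by rewrite -addnS; apply: coef_homogM; [apply: coef_homog_dx|apply: coef_homog_dxi].
Qed.

Lemma euler_dx R : coef_homog 1 R -> \sum_i fn 'X_i * dx i R = R.
Proof.
move=> /coef_homogP r1; apply/ffunP => I; rewrite mv_sumE -[RHS]euler_linear //.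
by apply: eq_bigr => i _; rewrite fnME dxE.
Qed.

Lemma xi_dxi i R I : (xi K i * dxi i R) I = if i \in I then R I else 0.
Proof.
rewrite mv_mulE; case: ifPn => iI.
  rewrite (bigD1 [set i]) ?sub1set //= big1 ?addr0 => [|A /andP[_ /negPf nA]].
    rewrite ffunE eqxx mul1r dxiE !inE eqxx /= setD1K // mulrA -expr2 sqrr_sign.
    by rewrite mul1r.
  by rewrite ffunE nA mul0r mulr0.
rewrite big1 // => A sAI; rewrite ffunE; case: eqP => [eA|_]; last by rewrite mul0r mulr0.
by rewrite eA sub1set (negPf iI) in sAI.
Qed.

(** Euler's identity in the odd variables. *)
Lemma euler_dxi d R : deg d R -> \sum_i xi K i * dxi i R = R *+ d.
Proof.
move=> dR; apply/ffunP => I; rewrite mv_sumE; under eq_bigr do rewrite xi_dxi.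
rewrite -big_mkcond sumr_const.
have -> : (R *+ d) I = R I *+ d.
  by elim: (d) => [|k IH]; rewrite ?mulr0n ?mv_0E // !mulrS mv_addE IH.
have [->|/(degP _ _ dR) -> //] := eqVneq (R I) 0; by rewrite !mul0rn.
Qed.
End Chom.

Lemma coef_homog_liftmv d (R : multivector K 8) : coef_homog d R -> coef_homog d (liftmv R).
Proof.
move=> /coef_homogP rd; apply/coef_homogP => I; case: (upP I) => [I0|[J ->]].
  by rewrite liftmv_ord0 // rpred0.
by rewrite liftmvE lift_poly_dhomog.
Qed.

Lemma evalmv_liftmv (a : 'I_9 -> K) d (R : multivector K 8) :
  (forall k, a (lift ord0 k) = 0) -> coef_homog d.+1 R -> evalmv a (liftmv R) = 0.
Proof.
move=> a0 /coef_homogP rd; apply/ffunP => I; rewrite evalmvE mv_0E; case: (upP I) => [I0|[J ->]].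
  by rewrite liftmv_ord0 // meval0 mpolyC0.
by rewrite liftmvE (lift_poly_central a0 (rd J)) mpolyC0.
Qed.
End HomogPoly.

(** * The quadratic Poisson bivector *)

Section SL3Fields.
Variable K : fieldType.
Notation mv := (multivector K 8).

Lemma sl3_lin_dhomog (M : 'M[K]_3) : sl3_lin M \is 1.-homog.
Proof.
by apply: rpred_sum => k _; apply: dhomogZ; rewrite dhomogX; apply/eqP/mdeg1.
Qed.

Lemma coef_homog_P : coef_homog 1 (P K : mv).
Proof.
rewrite [P K]lie_poissonE; apply: coef_homog_sum => i _; apply: coef_homog_sum => j _.
exact: coef_homogM (coef_homog_fn (sl3_lin_dhomog _))
  (coef_homogM (coef_homog_xi K i) (coef_homog_xi K j)).
Qed.

Lemma coef_homog_Pham (M : 'M[K]_3) : coef_homog 1 (Pham (sl3_lin M) : mv).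
Proof. exact: (coef_homog_bracket coef_homog_P (coef_homog_fn (sl3_lin_dhomog M))). Qed.

Lemma deg_Pham (M : 'M[K]_3) : deg 1 (Pham (sl3_lin M) : mv).
Proof. exact: (deg_bracket (deg_P K) (deg_fn (sl3_lin M))). Qed.

Definition quadratic_vector_field (X : mv) := deg 1 X && coef_homog 2 X.

Lemma quadratic_Pham (M : 'M[K]_3) (X : mv) : quadratic_vector_field X ->
  quadratic_vector_field (- schouten (Pham (sl3_lin M)) X : mv).
Proof.
case/andP => dX cX; apply/andP; split.
  exact: degN (deg_bracket (deg_Pham M) dX).
exact: coef_homogN (coef_homog_bracket (coef_homog_Pham M) cX).
Qed.

Lemma dhomog_natM n d k (f : {mpoly K[n]}) : f \is d.-homog -> k%:R * f \is d.-homog.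
Proof. by move=> fd; rewrite mulr_natl rpredMn. Qed.

Lemma quadratic_X0 : quadratic_vector_field (X0 K).
Proof.
apply/andP; split.
  apply: deg_sum => i _; exact: (degM (deg_fn _) (deg_xi K i)).
apply: coef_homog_sum => i _.
apply: (@coef_homogM _ _ 2 0 (fn _) (xi K i) _ (coef_homog_xi K i)).
have lin2 (f g : {mpoly K[8]}) : f \is 1.-homog -> g \is 1.-homog -> f * g \is 2.-homog.
  by move=> f1 g1; exact: (dhomogM f1 g1).
apply: coef_homog_fn.
by case: i => [[|[|[|[|[|[|[|[|i]]]]]]]] hi] //=; rewrite ?expr2 ?mulNr;
  repeat first [exact: sl3_lin_dhomog | apply: rpredB | apply: rpredD | rewrite rpredN
               | apply: dhomog_natM | apply: lin2].
Qed.

Lemma quadratic_Xb (b : 'rV[K]_10) : quadratic_vector_field (Xb b).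
Proof.
have q0 := quadratic_X0.
(* X7, X8 and X9 are brackets with X6, X4 and X3. *)
have q4 : quadratic_vector_field (X4 K) by exact: quadratic_Pham.
have q3 : quadratic_vector_field (X3 K) by exact: quadratic_Pham.
have q6 : quadratic_vector_field (X6 K) by exact: quadratic_Pham.
have q (k : 'I_10) : quadratic_vector_field
    [:: X0 K; X1 K; X2 K; X3 K; X4 K; X5 K; X6 K; X7 K; X8 K; X9 K]`_k.
  have qP M X : quadratic_vector_field X -> quadratic_vector_field _ := @quadratic_Pham M X.
  case: k => [[|[|[|[|[|[|[|[|[|[|//]]]]]]]]]] hk].
  - exact: q0.
  - exact: (qP (Emx K 1 2) _ q0).
  - exact: (qP (Emx K 1 3) _ q0).
  - exact: q3.
  - exact: q4.
  - exact: (qP (Emx K 3 1) _ q0).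
  - exact: q6.
  - exact: (qP (Emx K 1 2) _ q6).
  - exact: (qP (Emx K 1 3) _ q4).
  - exact: (qP (Emx K 3 1) _ q3).
apply/andP; split.
  by apply: deg_sum => k _; apply: degZ; case/andP: (q k).
by apply: coef_homog_sum => k _; apply: coef_homogZ; case/andP: (q k).
Qed.

(** The Lie derivative along a linear Hamiltonian field preserves the degree of polynomials. *)
Lemma in_U_dhomog (f : {mpoly K[8]}) : in_U f -> f \is 2.-homog.
Proof.
elim=> [||{}f g _ fd _ gd|a {}f _ fd|M {}f g _ _ fd e].
- rewrite expr2; exact: (dhomogM (sl3_lin_dhomog _) (sl3_lin_dhomog _)).
- exact: rpred0.
- exact: rpredD.
- exact: dhomogZ.
have /coef_homogP/(_ set0) := coef_homog_bracket (coef_homog_Pham M) (coef_homog_fn fd).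
by rewrite [bracket _ _](esym e) ffunE eqxx.
Qed.
End SL3Fields.

Section GL3.
Variable K : fieldType.
Hypothesis charK : [pchar K] =i pred0.
Notation mv8 := (multivector K 8).
Notation mv9 := (multivector K 9).
Notation t := (fn (x0 K) : mv9).
Notation xi0 := (xi K ord0 : mv9).

(** The row and the column of the central basis element are zero. *)
Lemma pi1E c : pi1 c = liftmv (P K).
Proof.
rewrite [P K]lie_poissonE.
pose g := gl3_basis c.
transitivity (\sum_(i < 9) \sum_(j < 9 | (i < j)%N)
   fn (gl3_lin c (mxcomm g`_i g`_j)) * (xi K i * xi K j) : mv9); first by [].
have lin0 : gl3_lin c 0 = 0.
  rewrite /gl3_lin mxtrace0 mul0r scale0r add0r mul0r raddf0 subr0 linear0.
  by rewrite /lift_poly raddf0.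
rewrite big_ord_recl [X in X + _]big1 ?add0r => [|j _]; last first.
  by rewrite /mxcomm scalar_mxC subrr lin0 raddf0 mul0r.
rewrite raddf_sum; apply: eq_bigr => i _.
rewrite raddf_sum [LHS]big_mkcond big_ord_recl ltn0 /= add0r [RHS]big_mkcond /=.
apply: eq_bigr => j _; rewrite /bump !add1n ltnS; case: ifP => // _.
rewrite !liftmvM liftmv_fn !liftmv_xi; congr (fn _ * _).
by rewrite /gl3_lin mxcomm_trace !mul0r scale0r add0r raddf0 subr0.
Qed.


Lemma neg_ad_liftmv (R Q : mv8) : neg_ad (liftmv R) (liftmv Q) = liftmv (neg_ad R Q).
Proof.
rewrite /neg_ad big_ord_recl !dxi0_liftmv !dx0_liftmv !mul0r addr0 add0r raddf_sum.
by apply: eq_bigr => k _; rewrite !(dxi_liftmv, dx_liftmv) raddfD /= !liftmvM.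
Qed.

Lemma dx_x0 i : dx i t = (i == ord0)%:R.
Proof.
rewrite dx_fn mderivXU eq_sym; case: (i == ord0); first exact: fn1.
by rewrite mulr0n raddf0.
Qed.

Lemma neg_ad_x0 (A : mv9) : neg_ad A t = dxi ord0 A.
Proof.
rewrite /neg_ad (bigD1 ord0) //= big1 ?addr0 => [|i /negPf ni]; rewrite dxi_fn dx_x0 mulr0 addr0.
  by rewrite eqxx mulr1.
by rewrite ni mulr0.
Qed.

Lemma neg_ad_xi0 (A : mv9) : neg_ad A xi0 = dx ord0 A.
Proof.
rewrite /neg_ad (bigD1 ord0) //= big1 ?addr0 => [|i /negPf ni]; rewrite dx_xi dxi_xi mulr0 add0r.
  by rewrite eqxx mulr1.
by rewrite ni mulr0.
Qed.

(** The Leibniz rule in the left argument, for the factor x_0. *)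
Lemma neg_ad_x0M (A Q : mv9) : neg_ad (t * A) Q = t * neg_ad A Q + A * dxi ord0 Q.
Proof.
transitivity (\sum_i (t * (dxi i A * dx i Q + dx i A * dxi i Q) +
    (i == ord0)%:R * (A * dxi i Q))).
  apply: eq_bigr => i _; rewrite dxi_fnM dxM dx_x0 mulrDl mulrDr !mulrA.
  by rewrite -!addrA; congr (_ + _); rewrite addrC.
rewrite big_split /= -mulr_sumr; congr (_ + _).
rewrite (bigD1 ord0) //= big1 ?addr0 => [|i /negPf ->]; last by rewrite mul0r.
by rewrite mul1r.
Qed.

Lemma dxi_x0M i (A : mv9) : dxi i (t * A) = t * dxi i A.
Proof. exact: dxi_fnM. Qed.

(** The derivative along the central line only sees the coefficient x_0 of p. *)
Lemma dx0_pencil (A H p : mv9) : dx ord0 A = 0 -> dx ord0 H = 0 -> dx ord0 p = 0 ->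
  dx ord0 (A - H * xi0 + t * p) = p.
Proof.
move=> A0 H0 p0; rewrite raddfD raddfB /= !dxM A0 H0 p0.
by rewrite dx_xi dx_x0 eqxx mul0r !mulr0 !addr0 subrr add0r mul1r.
Qed.

Lemma evalmv_pencil a (A H p : mv9) : evalmv a A = 0 -> evalmv a H = 0 -> evalmv a p = 0 ->
  evalmv a (A - H * xi0 + t * p) = 0.
Proof.
move=> A0 H0 p0; rewrite raddfD raddfB /= !evalmvM A0 H0 p0.
by rewrite mul0r mulr0 subrr addr0.
Qed.

(** The notation p, A, H is that of the opening comment, with f in the role of Q. *)
Section Pencil.
Variables (X : mv8) (f : {mpoly K[8]}).
Hypothesis dX : deg 1 X.
Hypothesis square : bracket (bracket X (P K)) (bracket X (P K)) =
  (bracket (P K) (fn f) * P K) *+ 2.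

Let p := liftmv (P K).
Let A := liftmv (bracket X (P K)).
Let H := liftmv (bracket (P K) (fn f)).
Let eul : mv8 := euler K 8.

Let dP : deg 2 (P K : mv8) := deg_P K.
Let dp : deg 2 p := deg_liftmv dP.
Let dA : deg 2 A := deg_liftmv (deg_bracket dX dP).
Let dH : deg 1 H := deg_liftmv (deg_bracket dP (deg_fn f)).

Let ddPP : neg_ad (P K) (P K) = 0.
Proof. by apply/eqP; rewrite -oppr_eq0 -(bracket_deg2 _ dP) sl3_poisson. Qed.

Let ddpp : neg_ad p p = 0. Proof. by rewrite neg_ad_liftmv ddPP raddf0. Qed.

Let ddpA : neg_ad p A = 0.
Proof. by rewrite neg_ad_liftmv (bracket_deg1 dX dP) (neg_ad_sq charK _ dP ddPP) raddf0. Qed.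

Let ddpH : neg_ad p H = 0.
Proof.
by rewrite neg_ad_liftmv (bracket_deg2 _ dP) neg_adNr (neg_ad_sq charK _ dP ddPP) oppr0 raddf0.
Qed.

Let ddAH : neg_ad A H = 0.
Proof.
rewrite neg_ad_liftmv -[neg_ad _ _]opprK -(bracket_deg2 _ (deg_bracket dX dP)).
rewrite (tangent_of_square charK dX dP (P_cube_neq0 charK) (sl3_poisson charK) square).
by rewrite oppr0 raddf0.
Qed.

Let ddAA : neg_ad A A = - (H * p) *+ 2.
Proof.
rewrite neg_ad_liftmv -[neg_ad _ _]opprK -(bracket_deg2 _ (deg_bracket dX dP)) square.
by rewrite raddfN raddfMn /= liftmvM mulNrn.
Qed.

Lemma eulerE : eul = \sum_i fn 'X_i * xi K i.
Proof. by []. Qed.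

Lemma dx_eul k : dx k eul = xi K k.
Proof.
rewrite eulerE raddf_sum (bigD1 k) //= big1 ?addr0 => [|i /negPf ik];
  rewrite dxM dx_xi mulr0 addr0 dx_fn mderivXU ?eqxx ?fn1 ?mul1r //.
by rewrite ik mulr0n raddf0 mul0r.
Qed.

Lemma dxi_eul k : dxi k eul = fn 'X_k.
Proof.
rewrite eulerE raddf_sum (bigD1 k) //= big1 ?addr0 => [|i /negPf ik];
  rewrite dxi_fnM dxi_xi ?eqxx ?mulr1 //.
by rewrite eq_sym ik mulr0.
Qed.

(** [E, P] = - P: the Euler field counts + 1 for the linear coefficients and - 2 for the two odd
    variables. *)
Lemma neg_ad_eul : neg_ad (P K) eul = - P K.
Proof.
rewrite /neg_ad; under eq_bigr do rewrite dx_eul dxi_eul Mfn.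
rewrite big_split /= euler_dx ?coef_homog_P //.
have -> : \sum_(k < 8) dxi k (P K) * xi K k = - (P K *+ 2 : mv8).
  rewrite -(euler_dxi dP) -sumrN; apply: eq_bigr => k _.
  exact: deg1N (deg_dxi k dP) (deg_xi K k).
by rewrite mulr2n opprD addrNK.
Qed.

Lemma deg_euler : deg 1 eul.
Proof. by rewrite eulerE; apply: deg_sum => i _; exact: degM (deg_fn _) (deg_xi K i). Qed.

Definition pencil : mv9 := A - H * xi0 + t * p.

Lemma deg_pencil : deg 2 pencil.
Proof.
apply: degD; last exact: degM (deg_fn _) dp.
by apply: degB dA _; exact: degM dH (deg_xi K _).
Qed.

(** Term by term: X gives A; f d gives the Hamiltonian field of f because p does not involve x_0;
    x_0 E gives - x_0 p because [E, p] = - p. *)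
Lemma bracket_Xtilde :
  bracket (liftmv X + fn (lift_poly f) * xi0 - t * liftmv eul) p = pencil.
Proof.
rewrite bracket_deg1 //; last first.
  apply: degB; last exact: degM (deg_fn _) (deg_liftmv deg_euler).
  by apply: degD (deg_liftmv dX) _; exact: degM (deg_fn _) (deg_xi K _).
rewrite neg_adBr neg_adDr; congr (_ + _ + _).
- by rewrite neg_ad_liftmv -(bracket_deg1 dX dP).
- rewrite neg_adM // neg_ad_xi0 dx0_liftmv mulr0 addr0 -liftmv_fn neg_ad_liftmv.
  rewrite -mulNr; congr (_ * _).
  by rewrite /H (bracket_deg2 _ dP) raddfN opprK.
rewrite neg_adM // neg_ad_x0 dxi0_liftmv mul0r add0r (rho_deg (deg_fn _)) /=.
by rewrite neg_ad_liftmv neg_ad_eul raddfN mulrN opprK.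
Qed.

(** The names of the five auxiliary brackets list their two arguments; tp_Hxi is the cross term
    which compensates [A, A]. *)
Lemma neg_ad_pencil : neg_ad pencil pencil = 0.
Proof.
have dHxi : deg 2 (H * xi0) := degM dH (deg_xi K _).
have dtp : deg 2 (t * p) := degM (deg_fn _) dp.
have A_Hxi : neg_ad A (H * xi0) = 0.
  by rewrite neg_adM // ddAH neg_ad_xi0 dx0_liftmv mulr0 mul0r addr0.
have A_tp : neg_ad A (t * p) = 0.
  by rewrite neg_adM // neg_ad_x0 dxi0_liftmv (neg_ad_sym dA dp) ddpA mulr0 mul0r addr0.
have Hxi_Hxi : neg_ad (H * xi0) (H * xi0) = 0.
  rewrite (neg_ad_self dHxi) big1 ?mul0rn // => i _.
  rewrite dxM dx_xi mulr0 addr0 dxiM dxi_xi mulrDl.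
  rewrite -mulrA [xi0 * _]mulrA (deg1C (dx i H) (deg_xi K ord0)) -!mulrA.
  rewrite (deg1_sq charK (deg_xi K ord0)) !mulr0 add0r.
  by case: eqP => [->|_]; rewrite ?dx0_liftmv ?(mul0r, mulr0).
have tp_Hxi : neg_ad (t * p) (H * xi0) = - (H * p).
  rewrite neg_adM // neg_ad_x0M ddpH mulr0 add0r dxi0_liftmv mulr0 mul0r add0r.
  rewrite neg_ad_xi0 dxM dx0_liftmv mulr0 addr0 dx_x0 eqxx mul1r (rho_deg dH) /=.
  by rewrite mulNr.
have tp_tp : neg_ad (t * p) (t * p) = 0.
  rewrite neg_ad_x0M dxi_x0M dxi0_liftmv !mulr0 addr0 neg_adM // neg_ad_x0 dxi0_liftmv.
  by rewrite mul0r ddpp !mulr0 addr0 mulr0.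
rewrite /pencil neg_adDl neg_adBl !(fun B => neg_adDr B (A - H * xi0) (t * p)) !neg_adBr.
rewrite (neg_ad_sym dHxi dA) (neg_ad_sym dtp dA) (neg_ad_sym dHxi dtp).
rewrite A_Hxi A_tp Hxi_Hxi tp_Hxi tp_tp ddAA.
rewrite !(subr0, addr0, add0r, sub0r, opprK) mulr2n.
by rewrite subrK addNr.
Qed.

Lemma pencilE :
  pencil = bracket (liftmv X) p - bracket p (fn (lift_poly f)) * xi0 + t * p.
Proof. by rewrite /pencil -liftmv_fn !bracket_liftmv. Qed.

Lemma coef_homog_pencil : coef_homog 2 X -> f \is 2.-homog -> coef_homog 2 pencil.
Proof.
move=> cX cf; have cP := coef_homog_P K.
apply: coef_homogD; first apply: coef_homogB.
- exact: coef_homog_liftmv (coef_homog_bracket cX cP).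
- apply: (@coef_homogM _ _ 2 0); last exact: coef_homog_xi.
  exact: coef_homog_liftmv (coef_homog_bracket cP (coef_homog_fn cf)).
apply: (@coef_homogM _ _ 1 1); last exact: coef_homog_liftmv.
by apply: coef_homog_fn; rewrite dhomogX; apply/eqP/mdeg1.
Qed.

Lemma pencil_poisson : bracket pencil pencil = 0.
Proof. by rewrite (bracket_deg2 _ deg_pencil) neg_ad_pencil oppr0. Qed.

Lemma bracket_xi0_pencil : bracket xi0 pencil = p.
Proof.
rewrite (bracket_deg1 (deg_xi K ord0) deg_pencil) neg_ad_xi0.
by apply: dx0_pencil; exact: dx0_liftmv.
Qed.

Lemma pencil_vanishes (a : 'I_9 -> K) : coef_homog 2 X -> f \is 2.-homog ->
  (forall k, a (lift ord0 k) = 0) -> evalmv a pencil = 0.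
Proof.
move=> cX cf a0; have cP := coef_homog_P K.
apply: evalmv_pencil; first exact: evalmv_liftmv a0 (coef_homog_bracket cX cP).
  exact: evalmv_liftmv a0 (coef_homog_bracket cP (coef_homog_fn cf)).
exact: evalmv_liftmv a0 cP.
Qed.
End Pencil.

Lemma const_field_delta : const_field (delta_mx 0 ord0 : 'rV[K]_9) = xi0.
Proof.
rewrite /const_field (bigD1 ord0) //= big1 => [|i /negPf ni].
  by rewrite addr0 mxE !eqxx scale1r.
by rewrite mxE ni andbF scale0r.
Qed.

Lemma linearizable_pencil (c : K) (b : 'rV[K]_10) (Q : {mpoly K[8]}) :
  in_U Q ->
  schouten (schouten (Xb b) (P K)) (schouten (Xb b) (P K))
    = wedge (schouten (P K) (mvfun Q)) (P K) *+ 2 ->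
  let pi2 := schouten (Xtilde b Q) (pi1 c) in
  [/\ pi2 = schouten (lift_field (Xb b)) (pi1 c)
            - wedge (schouten (pi1 c) (mvfun (lift_poly Q))) (d0 K)
            + wedge (mvfun (x0 K)) (pi1 c),
      is_bivector pi2,
      is_quadratic pi2,
      is_poisson pi2 &
      centrally_linearizable c pi2].
Proof.
move=> QU square pi2; have /andP[dX cX] := quadratic_Xb b.
have cQ := in_U_dhomog QU.
have -> : pi2 = pencil (Xb b) Q.
  by rewrite /pi2 pi1E; exact: (bracket_Xtilde Q dX).
have cp := coef_homog_pencil cX cQ.
split.
- by rewrite pi1E; exact: pencilE.
- by apply/degP; exact: (deg_pencil Q dX).
- exact/coef_homogP.
- exact: (pencil_poisson dX square).
(* The unit vector along the central line. *)
exists (delta_mx 0 ord0).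
have a0 k : (delta_mx 0 ord0 : 'rV[K]_9) 0 (lift ord0 k) = 0 by rewrite mxE andbF.
split=> //.
- by apply/eqP => /rowP/(_ ord0)/eqP; rewrite !mxE !eqxx oner_eq0.
- move=> I; have := congr1 (fun R : mv9 => R I) (pencil_vanishes cX cQ a0).
  by rewrite evalmvE mv_0E => /eqP; rewrite mpolyC_eq0 => /eqP.
by rewrite const_field_delta pi1E; exact: (bracket_xi0_pencil Q dX).
Qed.
End GL3.

Lemma pchar_scalars (R : realType) (s : real_or_complex) : [pchar (scalars R s)] =i pred0.
Proof. by case: s; [exact: (@Num.Theory.pchar_num R)|exact: (@Num.Theory.pchar_num R[i])]. Qed.

Theorem theorem6p2 (R : realType) (s : real_or_complex)
    (c : scalars R s) (hc : c != 0)
    (b : 'rV[scalars R s]_10) (Q : {mpoly (scalars R s)[8]})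
    (hQU : in_U Q)
    (hQ : schouten (schouten (Xb b) (P _)) (schouten (Xb b) (P _))
          = wedge (schouten (P _) (mvfun Q)) (P _) *+ 2) :
  let pi2 := schouten (Xtilde b Q) (pi1 c) in
  [/\ pi2 = schouten (lift_field (Xb b)) (pi1 c)
            - wedge (schouten (pi1 c) (mvfun (lift_poly Q))) (d0 _)
            + wedge (mvfun (x0 _)) (pi1 c),
      is_bivector pi2,
      is_quadratic pi2,
      is_poisson pi2 &
      centrally_linearizable c pi2].
Proof. exact: (linearizable_pencil (@pchar_scalars R s) c hQU hQ). Qed.
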